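(* Let $p,q\ge 3$ be two integers. For a spatial embedding $f$ of the complete graph $K_{p+q}$ and a positive integer $m$, if $pq>90(m-1)^2$, then there exists a pair of disjoint cycles $\lambda\in\Gamma_{p,q}(K_{p+q})$ such that $|\mathrm{lk}(f(\lambda))|\ge m$.
   Context: We work in the piecewise linear category. $K_n$ is the complete graph on the $n$ vertices $1,\dots,n$. A spatial embedding of a finite graph $G$ is a (piecewise linear) embedding $f$ of $G$ into $\mathbb{R}^3$. A cycle of $G$ is a subgraph homeomorphic to a circle; a $p$-cycle is a cycle with exactly $p$ edges. $\Gamma_{p,q}(G)$ denotes the set of all unordered pairs $\lambda=\gamma\cup\gamma'$ of two (vertex-)disjoint cycles of $G$ consisting of a $p$-cycle and a $q$-cycle. For such $\lambda$, $f(\lambda)$ is a 2-component link and $\mathrm{lk}(f(\lambda))$ is its linking number; it is defined up to sign unless the components are oriented, so $|\mathrm{lk}(f(\lambda))|$ is well defined. *)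

(* Defs.v *)
From HB Require Import structures.
From mathcomp Require Import all_boot all_order all_algebra.
From mathcomp Require Import boolp classical_sets reals.

Set Implicit Arguments.
Unset Strict Implicit.
Unset Printing Implicit Defensive.

Import Order.TTheory GRing.Theory Num.Theory.
Local Open Scope ring_scope.

(* Simple graphs are symmetric irreflexive relations on a finite type. *)
Definition complete_graph (n : nat) : rel 'I_n := fun i j => i != j.
Arguments complete_graph : clear implicits.

(* A p-cycle is given by its vertices listed in cyclic order; the lists of one
   cycle differ by rotation (same polygon) and reversal (opposite orientation).
   The bound on p excludes the degenerate closed walks x, y, x. *)
Definition is_cycle (V : finType) (e : rel V) (p : nat) (c : seq V) : Prop :=
  [/\ (3 <= p)%N, size c = p & ucycle e c].

(* Gamma_{p,q}(G).  A pair of disjoint cycles is listed with its p-cycle first;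
   for p = q each unordered pair is listed in both orders. *)
Definition Gamma (V : finType) (e : rel V) (p q : nat) : set (seq V * seq V) :=
  [set c | [/\ is_cycle e p c.1, is_cycle e q c.2 & ~~ has (mem c.1) c.2]].

Section Space.
Variable R : realType.
Local Notation point := 'rV[R]_3.

Definition seg_point (a b : point) (t : R) : point := (1 - t) *: a + t *: b.

(* Affine on each [k, k + 1], with value s`_k at k, for 0 <= t <= size s - 1. *)
Definition polyline (s : seq point) (t : R) : point :=
  let k := Num.truncn t in seg_point s`_k s`_k.+1 (t - k%:R).

Definition arc_path (V : finType) (pos : V -> point)
    (bends : V -> V -> seq point) (x y : V) : seq point :=
  pos x :: rcons (bends x y) (pos y).

Definition arc_length (V : finType) (bends : V -> V -> seq point) (x y : V) : R :=
  (size (bends x y)).+1%:R.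

(* The edge xy is mapped to the polygonal arc from pos x to pos y with
   successive interior breakpoints bends x y.  The space |G| is the disjoint
   union of the vertices and of the open edges, so the last three fields say
   that the resulting map from |G| to R^3 is injective. *)
Record spatial_embedding (V : finType) (e : rel V) := SpatialEmbedding {
  pos : V -> point;
  bends : V -> V -> seq point;
  bends_rev : forall x y, e x y -> bends y x = rev (bends x y);
  pos_inj : injective pos;
  edge_avoids_vertices : forall x y z t, e x y ->
    0 < t < arc_length bends x y ->
    polyline (arc_path pos bends x y) t <> pos z;
  edge_inj : forall x y z w s t, e x y -> e z w ->
    0 < s < arc_length bends x y -> 0 < t < arc_length bends z w ->
    polyline (arc_path pos bends x y) s = polyline (arc_path pos bends z w) t ->
    [/\ x = z, y = w & s = t] \/
    [/\ x = w, y = z & s = arc_length bends x y - t]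
}.

(* Image of a cycle, as the cyclic list of the vertices of a closed polygon. *)
Definition cycle_image (V : finType) (e : rel V) (f : spatial_embedding e)
    (c : seq V) : seq point :=
  flatten [seq pos f x :: bends f x (next c x) | x <- c].

Definition polygon_edges (P : seq point) : seq (point * point) :=
  zip P (rot 1 P).

Definition vertices_off_edges (u : point) (P Q : seq point) : Prop :=
  forall a ed, a \in P -> ed \in polygon_edges Q ->
  forall r t : R, 0 <= t <= 1 -> a + r *: u <> seg_point ed.1 ed.2 t.

(* In the projection along u, no vertex of one polygon lies on the other one;
   hence the two meet only in transversal crossings of interiors of edges.
   Self-crossings of P and of Q are irrelevant to the linking number. *)
Definition regular_direction (P Q : seq point) : set point :=
  [set u | [/\ u != 0, vertices_off_edges u P Q & vertices_off_edges u Q P]].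

Definition det3 (a b c : point) : R :=
  \det (\matrix_(i < 3) [:: a; b; c]`_i).

(* The viewer is at infinity in the direction of u. *)
Definition passes_over (u : point) (ed ed' : point * point) : Prop :=
  exists s t r : R, [/\ 0 <= s <= 1, 0 <= t <= 1, 0 < r &
    seg_point ed.1 ed.2 s = seg_point ed'.1 ed'.2 t + r *: u].

(* Positive if, seen by the viewer, the direction of ed is turned
   counterclockwise to that of ed' (by less than pi). *)
Definition orientation_sign (u : point) (ed ed' : point * point) : int :=
  sgz (det3 (ed.2 - ed.1) (ed'.2 - ed'.1) u).

Definition crossing_sign (u : point) (ed ed' : point * point) : int :=
  if `[< passes_over u ed ed' >] then orientation_sign u ed ed'
  else if `[< passes_over u ed' ed >] then orientation_sign u ed' ed
  else 0.

Definition crossing_sum (u : point) (P Q : seq point) : int :=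
  \sum_(ed <- polygon_edges P) \sum_(ed' <- polygon_edges Q)
    crossing_sign u ed ed'.

(* Half the sum of the signs of the crossings between P and Q in a regular
   projection; the result does not depend on which one is chosen.  The default
   0 is never used for disjoint P and Q, which have a regular direction. *)
Definition linking_number (P Q : seq point) : rat :=
  (crossing_sum (xget 0 (regular_direction P Q)) P Q)%:~R / 2.

End Space.
Arguments spatial_embedding R {V} e.

(* Main.v *)
Require Import Defs.
From mathcomp Require Import fingroup perm.
From mathcomp Require Import all_boot all_order all_algebra.
From mathcomp Require Import boolp classical_sets reals.
From mathcomp Require Import ring lra zify.
From Stdlib Require Import Btauto.

Set Implicit Arguments.
Unset Strict Implicit.
Unset Printing Implicit Defensive.

Import Order.TTheory GRing.Theory Num.Theory.
Local Open Scope classical_set_scope.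
Local Open Scope ring_scope.

(** Why the theorem holds.

    Fix a direction [u] in general position and let [ell] of two disjoint
    oriented edges be the signed number of crossings, seen along [u], where the
    arc of the first passes over the arc of the second.  The linking number of
    two disjoint cycles is the sum of [ell] over their pairs of edges
    ([linking_number_arcs]).  This rests on the fact that the count of
    over-crossings of two disjoint closed polygons is the same for all regular
    directions ([over_sum_invariant]), so also for [u] and [- u], which exchange
    over and under: the half in the definition of the linking number disappears.
    To compare two directions [u] and [v], look at one edge of each polygon.
    Their differences fill a parallelogram that misses the origin, and an
    over-crossing means that the ray of the direction pierces it.  Turning the
    ray from [u] to [v] changes the count by the signed crossings of the sector
    between [u] and [v] with the four sides ([over_sign_change]); summed around
    closed polygons these side terms telescope to zero.

    The same formula for arcs with end points leaves boundary terms.  Turning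
    [u] through [v] to [- u] therefore expresses the number of crossings of two
    disjoint arcs modulo 2 by the arcs vertically below their end points
    ([crossing_parity]).  Added over the ten ways to split six vertices into two
    triangles, everything cancels except a constant: the sum of [ell] over some
    pair of triangles is odd, hence not zero ([linked_triangles]).  This is the
    theorem of Conway and Gordon for six vertices.

    Finally, relabel the vertices by a uniformly random permutation.  With the
    second cycle fixed, the first one sees an antisymmetric function [psi] on
    pairs of vertices.  Subtracting a coboundary changes no cycle sum and makes
    the row sums of [psi] vanish; then edges without common vertex are
    uncorrelated and the mean square of a cycle sum is proportional to the
    length of the cycle ([cycle_sum_average]).  Doing this for both cycles, the
    mean square of the linking number over pairs of a p-cycle and a q-cycle is
    pq/9 times the mean over pairs of triangles, which is at least 1/10
    ([triangle_moment]).  If pq/90 exceeds (m-1)^2, some linking number exceeds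
    m-1 in absolute value. *)

(** * Crossings of the axes by a plane segment *)

Section Sweep.
Variable R : realFieldType.
Implicit Types a b c d : R.

Definition indic (P : Prop) : int := (`[< P >] : nat)%:Z.

Lemma indic_iff (P Q : Prop) : (P <-> Q) -> indic P = indic Q.
Proof. by move=> PQ; rewrite /indic (asbool_equiv_eq PQ). Qed.

Lemma indicT (P : Prop) : P -> indic P = 1.
Proof. by move=> h; rewrite /indic; move/asboolP: h => ->. Qed.

Lemma indicF (P : Prop) : ~ P -> indic P = 0.
Proof. by move=> h; rewrite /indic; move/asboolPn: h => /negbTE ->. Qed.

Definition lin a b t := (1 - t) * a + t * b.

(** The parameter of the zero is [a / (a - b)]; clearing the square of the
    denominator turns the existential into polynomial inequalities. *)
Lemma lin_cross a b c d : a != 0 -> b != 0 ->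
  (exists t, [/\ 0 <= t <= 1, lin a b t = 0 & 0 < lin c d t]) <->
  a * b < 0 /\ 0 < (c * b - d * a) * (b - a).
Proof.
rewrite /lin => a0 b0; split=> [[t [/andP[t0 t1] h0 h1]]|[h0 h1]].
  have [d' [ea eb]] : exists d', a = t * d' /\ b = - ((1 - t) * d').
    by exists (a - b); split; lra.
  subst a b.
  have d0 : d' != 0 by apply: contraNneq a0 => ->; rewrite mulr0 eqxx.
  have tp : 0 < t.
    by rewrite lt0r t0 andbT; apply: contraNneq a0 => ->; rewrite mul0r eqxx.
  have tl : 0 < 1 - t.
    rewrite lt0r subr_ge0 t1 andbT.
    by apply: contraNneq b0 => ->; rewrite mul0r oppr0 eqxx.
  have sq : 0 < d' ^+ 2 by rewrite exprn_even_gt0.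
  split.
    have -> : t * d' * - ((1 - t) * d') = - (t * (1 - t) * d' ^+ 2) by ring.
    by rewrite oppr_lt0 mulr_gt0 // mulr_gt0.
  have -> : (c * - ((1 - t) * d') - d * (t * d')) * (- ((1 - t) * d') - t * d')
    = ((1 - t) * c + t * d) * d' ^+ 2 by ring.
  by rewrite mulr_gt0.
have nz : b - a != 0.
  by apply/eqP => h; have ba : b = a by [lra]; move: h0; rewrite ba; nra.
have sq : 0 < (b - a) ^+ 2 by rewrite exprn_even_gt0.
exists (- a / (b - a)); split.
- have h2 : - a * (b - a) = a ^+2 - a * b by ring.
  have -> : - a / (b - a) = (a ^+ 2 - a * b) / (b - a) ^+ 2 by field.
  rewrite divr_ge0 ?ler_pdivrMr ?sqr_ge0 ?mul1r //=; nra.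
- by field.
have -> : (1 - - a / (b - a)) * c + - a / (b - a) * d =
  ((c * b - d * a) * (b - a)) / (b - a) ^+ 2 by field.
by rewrite divr_gt0.
Qed.

(** A segment that avoids the origin crosses the boundary of the open positive
    quadrant once for each change between being inside and outside, through the
    positive x-axis or through the positive y-axis. *)
Lemma planar_sweep (X1 Y1 X2 Y2 : R) :
  X1 != 0 -> Y1 != 0 -> X2 != 0 -> Y2 != 0 ->
  (forall t, 0 <= t <= 1 -> ~ (lin X1 X2 t = 0 /\ lin Y1 Y2 t = 0)) ->
  sgz (Y2 - Y1) *
     indic (exists t, [/\ 0 <= t <= 1, lin Y1 Y2 t = 0 & 0 < lin X1 X2 t]) +
  sgz (X2 - X1) *
     indic (exists t, [/\ 0 <= t <= 1, lin X1 X2 t = 0 & 0 < lin Y1 Y2 t]) =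
  indic (0 < X2 /\ 0 < Y2) - indic (0 < X1 /\ 0 < Y1).
Proof.
move=> x1 y1 x2 y2 nz.
rewrite (indic_iff (lin_cross X1 X2 y1 y2)).
rewrite (indic_iff (lin_cross Y1 Y2 x1 x2)).
(* The sign of this determinant decides which half-axis is crossed; it vanishes
   only if the line of the segment contains the origin. *)
have det0 : X1 * X2 < 0 -> X1 * Y2 - X2 * Y1 != 0.
  move=> h; apply/eqP => d0.
  have nx : X2 - X1 != 0 by apply/eqP => e; nra.
  have sq : 0 < (X2 - X1) ^+ 2 by rewrite exprn_even_gt0.
  apply: (nz (- X1 / (X2 - X1))).
    have -> : - X1 / (X2 - X1) = (X1 ^+ 2 - X1 * X2) / (X2 - X1) ^+ 2 by field.
    rewrite divr_ge0 ?ler_pdivrMr ?sqr_ge0 ?mul1r //=; nra.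
  split; first by rewrite /lin; field.
  have -> : lin Y1 Y2 (- X1 / (X2 - X1)) = - (X1 * Y2 - X2 * Y1) / (X2 - X1).
    by rewrite /lin; field.
  by rewrite d0 oppr0 mul0r.
rewrite /indic !asbool_and !asboolb.
have sgp (z : R) : 0 < z -> sgz z = 1 by move=> ?; exact: gtr0_sgz.
have sgn (z : R) : z < 0 -> sgz z = -1 by move=> ?; exact: ltr0_sgz.
have subp (x y : R) : x < 0 -> 0 < y -> 0 < y - x.
  by move=> ? ?; rewrite subr_gt0 (@lt_trans _ _ 0).
have subn (x y : R) : 0 < x -> y < 0 -> y - x < 0.
  by move=> ? ?; rewrite subr_lt0 (@lt_trans _ _ 0).
have prod0 (x y : R) : 0 < x -> 0 < y -> (x * y < 0) = false.
  by move=> ? ?; apply: le_gtF; rewrite mulr_ge0 ?ltW.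
have prod1 (x y : R) : x < 0 -> y < 0 -> (x * y < 0) = false.
  by move=> ? ?; apply: le_gtF; rewrite mulr_le0 ?ltW.
have prod2 (x y : R) : x < 0 -> 0 < y -> (x * y < 0) = true.
  by move=> ? ?; rewrite nmulr_rlt0.
have prod3 (x y : R) : 0 < x -> y < 0 -> (x * y < 0) = true.
  by move=> ? ?; rewrite pmulr_rlt0.
have pp (x y : R) : 0 < y -> (0 < x * y) = (0 < x).
  by move=> ?; rewrite pmulr_lgt0.
have pn (x y : R) : y < 0 -> (0 < x * y) = (x < 0).
  by move=> ?; rewrite nmulr_lgt0.
have flip : Y1 * X2 - Y2 * X1 = - (X1 * Y2 - X2 * Y1) by ring.
rewrite flip.
set N := X1 * Y2 - X2 * Y1 in det0 *.
have sgn_cases (x : R) (P : Prop) : x != 0 ->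
  (x < 0 -> (0 < x) = false -> P) -> (0 < x -> (0 < x) = true -> P) -> P.
  by rewrite neq_lt => /orP[h|h] h1 h2; [apply: h1 => //; exact: lt_gtF|exact: h2].
apply: (sgn_cases X1) => // p1 ->; apply: (sgn_cases X2) => // p2 ->;
apply: (sgn_cases Y1) => // p3 ->; apply: (sgn_cases Y2) => // p4 ->.
all: move: det0;
  first [rewrite (prod0 _ _ p1 p2)|rewrite (prod1 _ _ p1 p2)
        |rewrite (prod2 _ _ p1 p2)|rewrite (prod3 _ _ p1 p2)];
  first [rewrite (prod0 _ _ p3 p4)|rewrite (prod1 _ _ p3 p4)
        |rewrite (prod2 _ _ p3 p4)|rewrite (prod3 _ _ p3 p4)];
  rewrite /= ?mulr0 ?addr0 ?add0r ?subrr //; move=> det0.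
all: try rewrite (sgp _ (subp _ _ p1 p2)) (pp _ _ (subp _ _ p1 p2)).
all: try rewrite (sgn _ (subn _ _ p1 p2)) (pn _ _ (subn _ _ p1 p2)).
all: try rewrite (sgp _ (subp _ _ p3 p4)) (pp _ _ (subp _ _ p3 p4)).
all: try rewrite (sgn _ (subn _ _ p3 p4)) (pn _ _ (subn _ _ p3 p4)).
all: rewrite ?oppr_lt0 ?oppr_gt0.
all: lazymatch goal with
  | |- context [_ + _] => case: (ltgtP N 0) => // /eqP; by rewrite (negbTE (det0 isT))
  | _ => idtac
  end.
all: first [have Ns : 0 < N by [rewrite /N; nra]|have Ns : N < 0 by [rewrite /N; nra]].
all: by rewrite ?Ns ?(lt_gtF Ns).
Qed.
End Sweep.

(** * A parallelogram seen from the origin *)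

Section Par.
Variable R : realFieldType.
Implicit Types a b s t : R.
(** Coordinates in a basis whose first two vectors are the two directions to be
    compared. *)
Definition vec : Type := (R * R * R)%type.
Implicit Types w e : vec.
Definition cx w := w.1.1. Definition cy w := w.1.2. Definition cz w := w.2.
Definition vadd w e : vec := (cx w + cx e, cy w + cy e, cz w + cz e).
Definition vopp w : vec := (- cx w, - cy w, - cz w).
Definition pgram w e1 e2 s t : vec :=
  (cx w + s * cx e1 + t * cx e2, cy w + s * cy e1 + t * cy e2,
   cz w + s * cz e1 + t * cz e2).

Definition meets_x w e1 e2 := exists s t, [/\ 0 <= s <= 1, 0 <= t <= 1,
   cy (pgram w e1 e2 s t) = 0, cz (pgram w e1 e2 s t) = 0 & 0 < cx (pgram w e1 e2 s t)].
Definition meets_y w e1 e2 := exists s t, [/\ 0 <= s <= 1, 0 <= t <= 1,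
   cx (pgram w e1 e2 s t) = 0, cz (pgram w e1 e2 s t) = 0 & 0 < cy (pgram w e1 e2 s t)].
Definition meets_quadrant w w' := exists t, [/\ 0 <= t <= 1, lin (cz w) (cz w') t = 0,
   0 < lin (cx w) (cx w') t & 0 < lin (cy w) (cy w') t].
Definition side_jump w w' : int :=
   (nat_of_bool (0 < cz w')%R)%:Z - (nat_of_bool (0 < cz w)%R)%:Z.
Definition side_term w w' : int := side_jump w w' * indic (meets_quadrant w w').

Definition general_position w e1 e2 :=
  [/\ [&& cz w != 0, cz (vadd w e1) != 0, cz (vadd w e2) != 0
        & cz (vadd (vadd w e1) e2) != 0],
   forall s t, 0 <= s <= 1 -> 0 <= t <= 1 ->
     [|| s == 0, s == 1, t == 0 | t == 1] -> cz (pgram w e1 e2 s t) = 0 ->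
     cx (pgram w e1 e2 s t) != 0 /\ cy (pgram w e1 e2 s t) != 0
   & forall s t, 0 <= s <= 1 -> 0 <= t <= 1 -> pgram w e1 e2 s t <> (0, 0, 0)].

Definition boundary w e1 e2 : int :=
  side_term w (vadd w e1) + side_term (vadd w e1) (vadd (vadd w e1) e2) +
  side_term (vadd (vadd w e1) e2) (vadd w e2) + side_term (vadd w e2) w.

(** The coefficients are two coordinates of the cross product of [e1] and [e2]:
    they give the side from which an axis pierces the parallelogram. *)
Definition sweep_identity w e1 e2 :=
  sgz (cy e1 * cz e2 - cz e1 * cy e2) * indic (meets_x w e1 e2) -
  sgz (cz e1 * cx e2 - cx e1 * cz e2) * indic (meets_y w e1 e2) = boundary w e1 e2.

Lemma pgram_rot w e1 e2 s t :
  pgram (vadd w e1) e2 (vopp e1) s t = pgram w e1 e2 (1 - t) s.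
Proof. by rewrite /pgram /vadd /vopp /cx /cy /cz /=; congr (_, _, _); ring. Qed.

Lemma onemI t : 0 <= t <= 1 -> 0 <= 1 - t <= 1.
Proof. by move=> /andP[h1 h2]; rewrite subr_ge0 h2 lerBlDr lerDl. Qed.

Lemma indic_eq (P Q : Prop) : (P -> Q) -> (Q -> P) -> indic P = indic Q.
Proof. by move=> pq qp; apply: indic_iff. Qed.

Lemma vec_rot_corner w e1 e2 : vadd (vadd (vadd w e1) e2) (vopp e1) = vadd w e2.
Proof. by rewrite /vadd /vopp /cx /cy /cz /=; congr (_, _, _); ring. Qed.
Lemma vec_addK w e : vadd (vadd w e) (vopp e) = w.
Proof. by case: w => [[x y] z]; rewrite /vadd /vopp /cx /cy /cz /=; congr (_, _, _); ring. Qed.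

(** Renaming the corners cyclically lets one corner stand for all four. *)
Lemma general_rot w e1 e2 :
  general_position w e1 e2 -> general_position (vadd w e1) e2 (vopp e1).
Proof.
move=> [hc hb h0]; split.
- rewrite vec_rot_corner vec_addK.
  by case/and4P: hc => -> -> -> ->.
- move=> s t hs ht bd; rewrite pgram_rot; apply: hb => //; first exact: onemI.
  by case/or4P: bd => /eqP ->; rewrite ?subr0 ?subrr ?eqxx ?orbT.
- by move=> s t hs ht; rewrite pgram_rot; apply: h0 => //; apply: onemI.
Qed.

Lemma sweep_rot w e1 e2 : sweep_identity (vadd w e1) e2 (vopp e1) -> sweep_identity w e1 e2.
Proof.
rewrite /sweep_identity /boundary vec_rot_corner vec_addK.
have -> : indic (meets_x (vadd w e1) e2 (vopp e1)) = indic (meets_x w e1 e2).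
  apply: indic_eq => [] [s [t [hs ht h1 h2 h3]]].
    by exists (1 - t), s; rewrite -pgram_rot onemI.
  by exists t, (1 - s); rewrite pgram_rot subKr onemI.
have -> : indic (meets_y (vadd w e1) e2 (vopp e1)) = indic (meets_y w e1 e2).
  apply: indic_eq => [] [s [t [hs ht h1 h2 h3]]].
    by exists (1 - t), s; rewrite -pgram_rot onemI.
  by exists t, (1 - s); rewrite pgram_rot subKr onemI.
have -> : cy e2 * cz (vopp e1) - cz e2 * cy (vopp e1) =
  cy e1 * cz e2 - cz e1 * cy e2 by rewrite /vopp /cy /cz /=; ring.
have -> : cz e2 * cx (vopp e1) - cx e2 * cz (vopp e1) =
  cz e1 * cx e2 - cx e1 * cz e2 by rewrite /vopp /cx /cz /=; ring.
by move=> ->; ring.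
Qed.

Lemma same_side a b t : a != 0 -> b != 0 -> (0 < a) = (0 < b) ->
  0 <= t <= 1 -> lin a b t != 0 /\ (0 < lin a b t) = (0 < a).
Proof.
rewrite /lin => a0 b0 e /andP[t0 t1].
have [ap|an|/eqP] := ltgtP a 0; last by rewrite (negbTE a0).
  have bn : b < 0
    by move: e; rewrite lt_gtF // => /esym; rewrite ltNge => /negbFE;
      rewrite le_eqVlt (negbTE b0).
  have h : (1 - t) * a + t * b < 0 by nra.
  by rewrite lt_eqF // (lt_gtF h).
have bp : 0 < b by rewrite -e.
have h : 0 < (1 - t) * a + t * b by nra.
by rewrite gt_eqF // h.
Qed.

Lemma meets_quadrant_at w w' t : 0 <= t <= 1 -> cz w != cz w' ->
  lin (cz w) (cz w') t = 0 ->
  meets_quadrant w w' <-> 0 < lin (cx w) (cx w') t /\ 0 < lin (cy w) (cy w') t.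
Proof.
move=> ht nz zt; split=> [[t' [_ zt' hx hy]]|[hx hy]]; last by exists t.
have -> // : t = t'.
have : (t - t') * (cz w' - cz w) = 0 by move: zt zt'; rewrite /lin; lra.
by move/eqP; rewrite mulf_eq0 !subr_eq0 (eq_sym (cz w')) (negbTE nz) orbF => /eqP.
Qed.

Lemma linI a b t :
  0 <= a <= 1 -> 0 <= b <= 1 -> 0 <= t <= 1 -> 0 <= lin a b t <= 1.
Proof.
move=> /andP[a0 a1] /andP[b0 b1] /andP[t0 t1].
have t1' : 0 <= 1 - t by rewrite subr_ge0.
apply/andP; split; first by rewrite addr_ge0 ?mulr_ge0.
rewrite -subr_ge0 (_ : 1 - _ = (1 - t) * (1 - a) + t * (1 - b)).
  by rewrite addr_ge0 ?mulr_ge0 ?subr_ge0.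
by rewrite /lin; ring.
Qed.

(** The plane [cz = 0] cuts the parallelogram in the segment from [c1] to [c2],
    to which [planar_sweep] applies.  Since [cz] is affine, the direction of the
    segment in parameter space is the multiple [k] of the gradient of [cz]
    turned by a right angle, and the sign of [k] tells at which end the boundary,
    followed counterclockwise, rises through the plane. *)
Lemma sweep_slice w e1 e2 s1 t1 s2 t2 k :
  general_position w e1 e2 ->
  let c1 := pgram w e1 e2 s1 t1 in let c2 := pgram w e1 e2 s2 t2 in
  0 <= s1 <= 1 -> 0 <= t1 <= 1 -> 0 <= s2 <= 1 -> 0 <= t2 <= 1 ->
  cz c1 = 0 -> cz c2 = 0 ->
  [|| s1 == 0, s1 == 1, t1 == 0 | t1 == 1] ->
  [|| s2 == 0, s2 == 1, t2 == 0 | t2 == 1] ->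
  (forall s t, 0 <= s <= 1 -> 0 <= t <= 1 -> cz (pgram w e1 e2 s t) = 0 ->
     exists tau, [/\ 0 <= tau <= 1, s = lin s1 s2 tau & t = lin t1 t2 tau]) ->
  k != 0 -> s2 - s1 = - k * cz e2 -> t2 - t1 = k * cz e1 ->
  sgz (cy e1 * cz e2 - cz e1 * cy e2) * indic (meets_x w e1 e2) -
  sgz (cz e1 * cx e2 - cx e1 * cz e2) * indic (meets_y w e1 e2) =
  sgz k * (indic (0 < cx c1 /\ 0 < cy c1) - indic (0 < cx c2 /\ 0 < cy c2)).
Proof.
move=> [hc hb h0] c1 c2 hs1 ht1 hs2 ht2 z1 z2 b1 b2 hslice k0 ek1 ek2.
have [x1 y1] := hb _ _ hs1 ht1 b1 z1.
have [x2 y2] := hb _ _ hs2 ht2 b2 z2.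
have ex tau : cx (pgram w e1 e2 (lin s1 s2 tau) (lin t1 t2 tau)) =
    lin (cx c1) (cx c2) tau by rewrite /c1 /c2 /pgram /lin /cx /=; ring.
have ey tau : cy (pgram w e1 e2 (lin s1 s2 tau) (lin t1 t2 tau)) =
    lin (cy c1) (cy c2) tau by rewrite /c1 /c2 /pgram /lin /cy /=; ring.
have ez tau : cz (pgram w e1 e2 (lin s1 s2 tau) (lin t1 t2 tau)) = 0.
  transitivity (lin (cz c1) (cz c2) tau); last by rewrite z1 z2 /lin; ring.
  by rewrite /c1 /c2 /pgram /lin /cz /=; ring.
have := @planar_sweep R (cx c1) (cy c1) (cx c2) (cy c2) x1 y1 x2 y2.
have hx : indic (meets_x w e1 e2) = indic (exists t, [/\ 0 <= t <= 1,
    lin (cy c1) (cy c2) t = 0 & 0 < lin (cx c1) (cx c2) t]).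
  apply: indic_eq => [[s [t [hs ht h1 h2 h3]]]|[tau [h1 h2 h3]]].
    have [tau [htau es et]] := hslice s t hs ht h2.
    by exists tau; rewrite -ex -ey -es -et.
  by exists (lin s1 s2 tau), (lin t1 t2 tau); rewrite ex ey ez !linI.
have hy : indic (meets_y w e1 e2) = indic (exists t, [/\ 0 <= t <= 1,
    lin (cx c1) (cx c2) t = 0 & 0 < lin (cy c1) (cy c2) t]).
  apply: indic_eq => [[s [t [hs ht h1 h2 h3]]]|[tau [h1 h2 h3]]].
    have [tau [htau es et]] := hslice s t hs ht h2.
    by exists tau; rewrite -ex -ey -es -et.
  by exists (lin s1 s2 tau), (lin t1 t2 tau); rewrite ex ey ez !linI.
rewrite -hx -hy => /(_ _)/wrap[].
  move=> t ht [h1 h2]; apply: (h0 (lin s1 s2 t) (lin t1 t2 t)); rewrite ?linI //.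
  move: (ex t) (ey t) (ez t); rewrite h1 h2.
  by case: (pgram _ _ _ _ _) => [[? ?] ?]; rewrite /cx /cy /cz /= => -> -> ->.
have ->: cy c2 - cy c1 = - k * (cy e1 * cz e2 - cz e1 * cy e2).
  transitivity ((s2 - s1) * cy e1 + (t2 - t1) * cy e2).
    by rewrite /c1 /c2 /pgram /cy /=; ring.
  by rewrite ek1 ek2; ring.
have ->: cx c2 - cx c1 = k * (cz e1 * cx e2 - cx e1 * cz e2).
  transitivity ((s2 - s1) * cx e1 + (t2 - t1) * cx e2).
    by rewrite /c1 /c2 /pgram /cx /=; ring.
  by rewrite ek1 ek2; ring.
rewrite !sgzM sgzN => h.
have kk : sgz k * sgz k = 1.
  by rewrite -sgzM gtr0_sgz // -expr2 exprn_even_gt0.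
set A := sgz (cy e1 * _ - _) in h *; set B := sgz (cz e1 * _ - _) in h *.
transitivity (sgz k * sgz k * (A * indic (meets_x w e1 e2) - B * indic (meets_y w e1 e2))).
  by rewrite kk mul1r.
transitivity (- sgz k * (- sgz k * A * indic (meets_x w e1 e2) +
  sgz k * B * indic (meets_y w e1 e2))); first by ring.
by rewrite h; ring.
Qed.

Lemma side_term0 w w' : (0 < cz w) = (0 < cz w') -> side_term w w' = 0.
Proof. by move=> e; rewrite /side_term /side_jump e subrr mul0r. Qed.

Lemma side_term_at w e1 e2 s1 t1 s2 t2 tau s t (c := pgram w e1 e2 s t) :
  0 <= tau <= 1 -> s = lin s1 s2 tau -> t = lin t1 t2 tau ->
  (0 < cz (pgram w e1 e2 s1 t1)) != (0 < cz (pgram w e1 e2 s2 t2)) ->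
  cz c = 0 ->
  side_term (pgram w e1 e2 s1 t1) (pgram w e1 e2 s2 t2) =
  side_jump (pgram w e1 e2 s1 t1) (pgram w e1 e2 s2 t2) * indic (0 < cx c /\ 0 < cy c).
Proof.
move=> ht es et ne hz; congr (_ * _); apply: indic_iff.
have -> : cx c = lin (cx (pgram w e1 e2 s1 t1)) (cx (pgram w e1 e2 s2 t2)) tau.
  by rewrite /c es et /pgram /lin /cx /=; ring.
have -> : cy c = lin (cy (pgram w e1 e2 s1 t1)) (cy (pgram w e1 e2 s2 t2)) tau.
  by rewrite /c es et /pgram /lin /cy /=; ring.
apply: meets_quadrant_at => //; first by apply: contraNneq ne => ->.
by rewrite -[RHS]hz /c es et /pgram /lin /cz /=; ring.
Qed.

Lemma boundary_pgram w e1 e2 : boundary w e1 e2 =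
  side_term (pgram w e1 e2 0 0) (pgram w e1 e2 1 0)
  + side_term (pgram w e1 e2 1 0) (pgram w e1 e2 1 1)
  + side_term (pgram w e1 e2 1 1) (pgram w e1 e2 0 1)
  + side_term (pgram w e1 e2 0 1) (pgram w e1 e2 0 0).
Proof.
have -> : pgram w e1 e2 0 0 = w.
  by case: w => [[x y] z]; rewrite /pgram /cx /cy /cz /= !mul0r !addr0.
by rewrite /boundary /pgram /vadd /cx /cy /cz /= !mul0r !mul1r !addr0.
Qed.

(** For an affine function on a side, with value [a] at the start and increment
    [b]: a change of sign puts the zero strictly inside the side. *)
Lemma zero_between a b : a != 0 -> (0 < a) != (0 < a + b) ->
  b != 0 /\ (a + b != 0 -> 0 < - a / b < 1).
Proof.
move=> a0 ne.
have b0 : b != 0 by apply: contraNneq ne => ->; rewrite addr0.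
split=> // ab0; have [bn|bp|/eqP] := ltgtP b 0; last by rewrite (negbTE b0).
  rewrite ltr_ndivlMr // ltr_ndivrMr // mul0r mul1r oppr_lt0.
  have ap : 0 < a.
    move: ne; rewrite lt0r a0 /= leNgt; case: (ltP a 0) => //= an.
    by rewrite lt_gtF // -[ltRHS]addr0 ltrD.
  rewrite ap; move: ne; rewrite ap eq_sym eqb_id -leNgt le_eqVlt (negbTE ab0) /=.
  by move=> h; clear -h; lra.
rewrite ltr_pdivlMr // ltr_pdivrMr // mul0r mul1r oppr_gt0.
have an : a < 0.
  move: ne; rewrite [a < 0]lt_neqAle a0 /= leNgt; case: (ltP 0 a) => //= ap.
  by rewrite addr_gt0.
rewrite an; move: ne; rewrite (lt_gtF an) eq_sym eqbF_neg negbK.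
by move=> h; clear -h; lra.
Qed.

Lemma cz_pgram w e1 e2 s t : cz (pgram w e1 e2 s t) = cz w + s * cz e1 + t * cz e2.
Proof. by []. Qed.

Lemma vadd_pgram w e1 e2 : [/\ w = pgram w e1 e2 0 0, vadd w e1 = pgram w e1 e2 1 0,
  vadd w e2 = pgram w e1 e2 0 1 & vadd (vadd w e1) e2 = pgram w e1 e2 1 1].
Proof.
split; last by rewrite /pgram /vadd /cx /cy /cz /= !mul1r.
- by case: w => [[x y] z]; rewrite /pgram /cx /cy /cz /= !mul0r !addr0.
- by rewrite /pgram /vadd /cx /cy /cz /= !mul0r !mul1r !addr0.
- by rewrite /pgram /vadd /cx /cy /cz /= !mul0r !mul1r !addr0.
Qed.

Lemma itv01 t : 0 < t < 1 -> 0 <= t <= 1.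
Proof. by case/andP=> h1 h2; rewrite !ltW. Qed.

Lemma itv0 : (0 <= 0 :> R) && (0 <= 1 :> R). Proof. by rewrite lexx ler01. Qed.
Lemma itv1 : (0 <= 1 :> R) && (1 <= 1 :> R). Proof. by rewrite lexx ler01. Qed.

Lemma side_jump_sgz w w' : (0 < cz w) != (0 < cz w') -> cz w != 0 -> cz w' != 0 ->
  side_jump w w' = sgz (cz w' - cz w).
Proof.
rewrite /side_jump; set a := cz w; set b := cz w' => ne a0 b0; move: ne.
have [h|h|/eqP] := ltgtP b 0; last by rewrite (negbTE b0).
  have [h'|h'|/eqP] := ltgtP a 0; rewrite ?(negbTE a0) // => _.
  by rewrite ltr0_sgz // subr_lt0 (lt_trans h).
have [h'|h'|/eqP] := ltgtP a 0; rewrite ?(negbTE a0) // => _.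
by rewrite gtr0_sgz // subr_gt0 (lt_trans h').
Qed.

Lemma sgzV (x : R) : sgz x^-1 = sgz x.
Proof.
have [h|h|->] := ltgtP x 0; last by rewrite invr0.
  by rewrite !ltr0_sgz ?invr_lt0.
by rewrite !gtr0_sgz ?invr_gt0.
Qed.

Lemma corners w e1 e2 : general_position w e1 e2 ->
  [/\ cz (pgram w e1 e2 0 0) != 0, cz (pgram w e1 e2 1 0) != 0,
      cz (pgram w e1 e2 0 1) != 0 & cz (pgram w e1 e2 1 1) != 0].
Proof.
move=> [/and4P[w0 w1 w2 w12] _ _]; move: w0 w1 w2 w12.
by have [e00 -> -> ->] := vadd_pgram w e1 e2; rewrite {1}e00.
Qed.

(** The plane separates two opposite sides, so that the cut runs from the side
    [t = 0] to the side [t = 1] and [t] itself is its parameter. *)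
Lemma sweep_band w e1 e2 : general_position w e1 e2 ->
  (0 < cz (pgram w e1 e2 0 0)) != (0 < cz (pgram w e1 e2 1 0)) ->
  (0 < cz (pgram w e1 e2 0 1)) = (0 < cz (pgram w e1 e2 0 0)) ->
  (0 < cz (pgram w e1 e2 1 1)) = (0 < cz (pgram w e1 e2 1 0)) ->
  sweep_identity w e1 e2.
Proof.
move=> gp ne1 eq1 eq2; have [w0 w1 w2 w12] := corners gp.
rewrite /sweep_identity boundary_pgram.
have := zero_between (b := cz e1) w0.
have -> : cz (pgram w e1 e2 0 0) + cz e1 = cz (pgram w e1 e2 1 0) by rewrite !cz_pgram; ring.
move=> /(_ ne1)[c10 /(_ w1) h1].
have := zero_between (b := cz e1) w2.
have -> : cz (pgram w e1 e2 0 1) + cz e1 = cz (pgram w e1 e2 1 1) by rewrite !cz_pgram; ring.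
rewrite eq1 eq2 => /(_ ne1)[_ /(_ w12) h2].
move: h1 h2; set s1 := - _ / _ ; set s2 := - _ / _ => h1 h2.
have z1 : cz (pgram w e1 e2 s1 0) = 0 by rewrite cz_pgram /s1 cz_pgram; field.
have z2 : cz (pgram w e1 e2 s2 1) = 0 by rewrite cz_pgram /s2 cz_pgram; field.
have k0 : (cz e1)^-1 != 0 by rewrite invr_eq0.
rewrite (@sweep_slice w e1 e2 s1 0 s2 1 (cz e1)^-1) ?itv0 ?itv1 ?itv01 ?eqxx ?orbT //.
- rewrite (side_term0 (esym eq2)) (side_term0 eq1).
  rewrite (@side_term_at w e1 e2 0 0 1 0 s1 s1 0) ?itv01 //; [|by rewrite /lin; ring..].
  rewrite (@side_term_at w e1 e2 1 1 0 1 (1 - s2) s2 1) ?onemI ?itv01 //;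
    [|by rewrite /lin; ring..|by rewrite eq1 eq2 eq_sym].
  rewrite !side_jump_sgz // ?eq1 ?eq2 1?eq_sym // sgzV.
  have -> : cz (pgram w e1 e2 1 0) - cz (pgram w e1 e2 0 0) = cz e1.
    by rewrite !cz_pgram; ring.
  have -> : cz (pgram w e1 e2 0 1) - cz (pgram w e1 e2 1 1) = - cz e1.
    by rewrite !cz_pgram; ring.
  by rewrite sgzN; ring.
- move=> s t hs ht; rewrite cz_pgram => zst; exists t; split=> //; last by rewrite /lin; ring.
  have -> : s = - (cz w + t * cz e2) / cz e1.
    by apply: (mulIf c10); rewrite mulfVK //; lra.
  by rewrite /lin /s1 /s2 !cz_pgram; field.
- by rewrite /s1 /s2 !cz_pgram; field.
- by rewrite subr0 mulVf.
Qed.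

(** The plane cuts off the corner [w]: the cut runs from the side [t = 0] to
    the side [s = 0]. *)
Lemma sweep_corner w e1 e2 : general_position w e1 e2 ->
  (0 < cz (pgram w e1 e2 0 0)) != (0 < cz (pgram w e1 e2 1 0)) ->
  (0 < cz (pgram w e1 e2 0 1)) = (0 < cz (pgram w e1 e2 1 0)) ->
  (0 < cz (pgram w e1 e2 1 1)) = (0 < cz (pgram w e1 e2 1 0)) ->
  sweep_identity w e1 e2.
Proof.
move=> gp ne1 eq1 eq2; have [w0 w1 w2 w12] := corners gp.
rewrite /sweep_identity boundary_pgram.
have := zero_between (b := cz e1) w0.
have -> : cz (pgram w e1 e2 0 0) + cz e1 = cz (pgram w e1 e2 1 0) by rewrite !cz_pgram; ring.
move=> /(_ ne1)[c10 /(_ w1) h1].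
have := zero_between (b := cz e2) w0.
have -> : cz (pgram w e1 e2 0 0) + cz e2 = cz (pgram w e1 e2 0 1) by rewrite !cz_pgram; ring.
rewrite eq1 => /(_ ne1)[c20 /(_ w2) h2].
move: h1 h2; set s1 := - _ / _ ; set t2 := - _ / _ => h1 h2.
have e00 : cz (pgram w e1 e2 0 0) = cz w by rewrite cz_pgram; ring.
rewrite e00 in s1 t2 h1 h2 w0 ne1.
have z1 : cz (pgram w e1 e2 s1 0) = 0 by rewrite cz_pgram /s1; field.
have z2 : cz (pgram w e1 e2 0 t2) = 0 by rewrite cz_pgram /t2; field.
have k0 : s1 / cz e2 != 0.
  by rewrite mulf_neq0 ?invr_eq0 //; case/andP: h1 => /lt0r_neq0.
have sk : sgz (s1 / cz e2) = sgz (cz e1).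
  rewrite sgzM sgzV gtr0_sgz ?mul1r; last by case/andP: h1.
  have : 0 < s1 / t2 by apply: divr_gt0; [case/andP: h1|case/andP: h2].
  have -> : s1 / t2 = cz e2 / cz e1 by rewrite /s1 /t2; field; rewrite ?oppr_eq0 ?w0 ?c10 ?c20.
  have [h|h|/eqP] := ltgtP (cz e1) 0; last by rewrite (negbTE c10).
    by rewrite ltr_ndivlMr // mul0r => ?; rewrite !ltr0_sgz.
  by rewrite ltr_pdivlMr // mul0r => ?; rewrite !gtr0_sgz.
rewrite (@sweep_slice w e1 e2 s1 0 0 t2 (s1 / cz e2)) ?itv0 ?itv1 ?itv01 ?eqxx ?orbT //.
- have eq3 : (0 < cz (pgram w e1 e2 1 1)) = (0 < cz (pgram w e1 e2 0 1)) by rewrite eq1 eq2.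
  rewrite (side_term0 (esym eq2)) (side_term0 eq3).
  rewrite (@side_term_at w e1 e2 0 0 1 0 s1 s1 0) ?itv01 ?e00 //; [|by rewrite /lin; ring..].
  rewrite (@side_term_at w e1 e2 0 1 0 0 (1 - t2) 0 t2) ?onemI ?itv01 ?e00 //;
    [|by rewrite /lin; ring..|by rewrite eq1 eq_sym].
  rewrite !side_jump_sgz // ?e00 // ?eq1 1?eq_sym // sk.
  have -> : cz (pgram w e1 e2 1 0) - cz w = cz e1.
    by rewrite !cz_pgram; ring.
  have -> : cz w - cz (pgram w e1 e2 0 1) = - cz e2.
    by rewrite !cz_pgram; ring.
  have -> : sgz (- cz e2) = - sgz (cz e1).
    by rewrite sgzN -sk sgzM sgzV [sgz s1]gtr0_sgz ?mul1r; last by case/andP: h1.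
  by ring.
- move=> s t /andP[hs _] /andP[ht _]; rewrite cz_pgram => zst; exists (t / t2).
  have t2p : 0 < t2 by case/andP: h2.
  have s1p : 0 < s1 by case/andP: h1.
  have es : s = s1 * (1 - t / t2).
    apply: (mulIf c10); rewrite /s1 /t2.
    have -> : s * cz e1 = - (cz w + t * cz e2) by clear -zst; lra.
    by field; rewrite ?oppr_eq0 ?w0 ?c10 ?c20.
  split.
  + rewrite divr_ge0 ?(ltW t2p) //= -subr_ge0.
    by rewrite -(pmulr_rge0 _ s1p) -es.
  + by rewrite es /lin; ring.
  + by rewrite /lin; field; rewrite gt_eqF.
- by rewrite sub0r mulNr divfK.
- by rewrite subr0 /s1 /t2; field; rewrite ?c10 ?c20.
Qed.

Lemma sweep_const w e1 e2 : general_position w e1 e2 ->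
  (0 < cz (pgram w e1 e2 0 0)) = (0 < cz (pgram w e1 e2 1 0)) ->
  (0 < cz (pgram w e1 e2 0 1)) = (0 < cz (pgram w e1 e2 1 0)) ->
  (0 < cz (pgram w e1 e2 1 1)) = (0 < cz (pgram w e1 e2 1 0)) ->
  sweep_identity w e1 e2.
Proof.
move=> gp eq0 eq1 eq2; have [w0 w1 w2 w12] := corners gp.
rewrite /sweep_identity boundary_pgram !side_term0 ?eq0 ?eq1 ?eq2 //.
have zne s t : 0 <= s <= 1 -> 0 <= t <= 1 -> cz (pgram w e1 e2 s t) != 0.
  move=> hs ht.
  have -> : cz (pgram w e1 e2 s t) =
     lin (lin (cz (pgram w e1 e2 0 0)) (cz (pgram w e1 e2 1 0)) s)
     (lin (cz (pgram w e1 e2 0 1)) (cz (pgram w e1 e2 1 1)) s) t.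
    by rewrite /lin !cz_pgram; ring.
  have [n1 s1] := same_side w0 w1 eq0 hs.
  have [n2 s2] := same_side w2 w12 (etrans eq1 (esym eq2)) hs.
  by have [] := same_side n1 n2 (etrans s1 (etrans eq0 (etrans (esym eq1) (esym s2)))) ht.
rewrite !indicF ?mulr0 ?subrr //.
- by move=> [s [t [hs ht _ /eqP h _]]]; move: (zne s t hs ht); rewrite h.
- by move=> [s [t [hs ht _ /eqP h _]]]; move: (zne s t hs ht); rewrite h.
Qed.

(** Opposite corners have the same sum, so the corners are never alternately on
    the two sides of the plane [cz = 0]; up to rotating the labels, only the
    three cases above remain. *)
Lemma parallelogram_sweep w e1 e2 : general_position w e1 e2 -> sweep_identity w e1 e2.
Proof.
have rotc u f1 f2 : [/\ pgram (vadd u f1) f2 (vopp f1) 0 0 = pgram u f1 f2 1 0,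
  pgram (vadd u f1) f2 (vopp f1) 1 0 = pgram u f1 f2 1 1,
  pgram (vadd u f1) f2 (vopp f1) 1 1 = pgram u f1 f2 0 1 &
  pgram (vadd u f1) f2 (vopp f1) 0 1 = pgram u f1 f2 0 0].
  by rewrite !pgram_rot !subrr !subr0.
pose sd (u f1 f2 : vec) := [:: 0 < cz (pgram u f1 f2 0 0); 0 < cz (pgram u f1 f2 1 0);
  0 < cz (pgram u f1 f2 1 1); 0 < cz (pgram u f1 f2 0 1)].
have sd_rot u f1 f2 : sd (vadd u f1) f2 (vopp f1) = rot 1 (sd u f1 f2).
  by rewrite /sd; have [-> -> -> ->] := rotc u f1 f2.
have base u f1 f2 : general_position u f1 f2 ->
    [|| sd u f1 f2 == [:: true; true; true; true],
        sd u f1 f2 == [:: false; false; false; false],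
        sd u f1 f2 == [:: true; false; false; false],
        sd u f1 f2 == [:: false; true; true; true],
        sd u f1 f2 == [:: true; false; false; true]
      | sd u f1 f2 == [:: false; true; true; false]] -> sweep_identity u f1 f2.
  move=> gp; rewrite /sd => h.
  case/or4P: h => [|||/or3P[||]] /eqP[a0 a1 a2 a3].
  1,2: by apply: sweep_const => //; rewrite ?a0 ?a1 ?a2 ?a3.
  1,2: by apply: sweep_corner => //; rewrite ?a0 ?a1 ?a2 ?a3.
  1,2: by apply: sweep_band => //; rewrite ?a0 ?a1 ?a2 ?a3.
move=> gp.
have rot1 := general_rot gp; have rot2 := general_rot rot1.
have rot3 := general_rot rot2.
have alt : ~~ ((sd w e1 e2 == [:: true; false; true; false]) ||
             (sd w e1 e2 == [:: false; true; false; true])).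
  have [w0 w1 w2 w12] := corners gp.
  have neg (x : R) : x != 0 -> (0 < x) = false -> x < 0.
    by move=> h /negbT; rewrite -leNgt le_eqVlt (negbTE h).
  apply/negP; rewrite /sd => /orP[] /eqP[a0 a1 a2 a3].
    move: (neg _ w1 a1) (neg _ w2 a3) => b1 b2.
    by rewrite !cz_pgram in b1 b2; clear -a0 a2 b1 b2; lra.
  move: (neg _ w0 a0) (neg _ w12 a2) => b1 b2.
  by rewrite !cz_pgram in b1 b2; clear -a1 a3 b1 b2; lra.
have b0 := base _ _ _ gp.
have b1 h := sweep_rot (base _ _ _ rot1 h).
have b2 h := sweep_rot (sweep_rot (base _ _ _ rot2 h)).
have b3 h := sweep_rot (sweep_rot (sweep_rot (base _ _ _ rot3 h))).
move: b1 b2 b3 b0 alt; rewrite !sd_rot /sd.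
by case: (0 < _); case: (0 < _); case: (0 < _); case: (0 < _) => b1 b2 b3 b0 // _;
  first [exact: b0|exact: b1|exact: b2|exact: b3].
Qed.

End Par.

(** * Crossings of two edges in space *)

Section Vec.
Variable R : realType.
Local Notation point := 'rV[R]_3.
Implicit Types u v w a b c e : point.

Definition i0 : 'I_3 := Ordinal (isT : 0 < 3)%N.
Definition i1 : 'I_3 := Ordinal (isT : 1 < 3)%N.
Definition i2 : 'I_3 := Ordinal (isT : 2 < 3)%N.

Lemma point_eq a b : a 0 i0 = b 0 i0 -> a 0 i1 = b 0 i1 -> a 0 i2 = b 0 i2 -> a = b.
Proof.
move=> h0 h1 h2; apply/rowP => [[[|[|[|//]]] h]].
- by rewrite (_ : Ordinal h = i0) //; apply: val_inj.
- by rewrite (_ : Ordinal h = i1) //; apply: val_inj.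
- by rewrite (_ : Ordinal h = i2) //; apply: val_inj.
Qed.

Lemma det3E a b c : det3 a b c =
  a 0 i0 * (b 0 i1 * c 0 i2 - b 0 i2 * c 0 i1)
  - a 0 i1 * (b 0 i0 * c 0 i2 - b 0 i2 * c 0 i0)
  + a 0 i2 * (b 0 i0 * c 0 i1 - b 0 i1 * c 0 i0).
Proof.
rewrite /det3 (expand_det_row _ ord0) !big_ord_recl big_ord0 /cofactor.
rewrite !(expand_det_row _ ord0) !big_ord_recl !big_ord0 /cofactor !det_mx11 !mxE /=.
rewrite (_ : ord0 = i0); last exact: val_inj.
repeat match goal with |- context [lift ?x ?y] =>
  first [rewrite (_ : lift x y = i1); last exact: val_inj
        |rewrite (_ : lift x y = i2); last exact: val_inj
        |rewrite (_ : lift x y = i0); last exact: val_inj] end.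
rewrite /= /bump /= !addn0 !expr0 ?expr1 ?expr2; ring.
Qed.

Lemma cramer u v e w : det3 u v e = 1 ->
  w = det3 w v e *: u + det3 u w e *: v + det3 u v w *: e.
Proof.
move=> h; apply/esym; rewrite -[RHS]scale1r -h.
by apply: point_eq; rewrite !mxE !det3E; ring.
Qed.

Lemma det3_lin1 u v a b (x y : R) :
  det3 (x *: a + y *: b) u v = x * det3 a u v + y * det3 b u v.
Proof. by rewrite !det3E !mxE; ring. Qed.
Lemma det3_lin2 u v a b (x y : R) :
  det3 u (x *: a + y *: b) v = x * det3 u a v + y * det3 u b v.
Proof. by rewrite !det3E !mxE; ring. Qed.
Lemma det3_lin3 u v a b (x y : R) :
  det3 u v (x *: a + y *: b) = x * det3 u v a + y * det3 u v b.
Proof. by rewrite !det3E !mxE; ring. Qed.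

(** The part of [crossing_sign] where the first edge is the upper one. *)
Definition over_sign u (ed ed' : point * point) : int :=
  orientation_sign u ed ed' * indic (passes_over u ed ed').

Definition meets_cone u v w w' := exists t x y : R,
  [/\ 0 <= t <= 1, 0 < x, 0 < y & seg_point w w' t = x *: u + y *: v].

(** The signed crossing of the segment from [w] to [w'] with the open sector
    spanned by [u] and [v]. *)
Definition cone_term u v w w' : int :=
  ((nat_of_bool (0 < det3 u v w')%R)%:Z - (nat_of_bool (0 < det3 u v w)%R)%:Z)
  * indic (meets_cone u v w w').

Definition ends_off_line u (ed ed' : point * point) := forall r t : R,
  0 <= t <= 1 -> ed.1 + r *: u <> seg_point ed'.1 ed'.2 t /\
                 ed.2 + r *: u <> seg_point ed'.1 ed'.2 t.

Definition disjoint_edges (ed ed' : point * point) := forall s t : R,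
  0 <= s <= 1 -> 0 <= t <= 1 -> seg_point ed.1 ed.2 s <> seg_point ed'.1 ed'.2 t.

Definition transverse u v (ed ed' : point * point) :=
  [&& det3 u v (ed.1 - ed'.1) != 0, det3 u v (ed.2 - ed'.1) != 0,
      det3 u v (ed.1 - ed'.2) != 0 & det3 u v (ed.2 - ed'.2) != 0].

(** In the basis [u], [v], [e] the differences of points of the two edges form
    a parallelogram, and an over-crossing along [u] (along [v]) is a point of it
    on the positive first (second) axis. *)
Lemma over_sign_change u v (ed ed' : point * point) :
  disjoint_edges ed ed' ->
  ends_off_line u ed ed' -> ends_off_line u ed' ed ->
  ends_off_line v ed ed' -> ends_off_line v ed' ed ->
  transverse u v ed ed' ->
  over_sign v ed ed' - over_sign u ed ed' =
  cone_term u v (ed.1 - ed'.1) (ed.2 - ed'.1)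
  + cone_term u v (ed.2 - ed'.1) (ed.2 - ed'.2)
  + cone_term u v (ed.2 - ed'.2) (ed.1 - ed'.2)
  + cone_term u v (ed.1 - ed'.2) (ed.1 - ed'.1).
Proof.
case: ed ed' => [A B] [C D] /=; rewrite /disjoint_edges /ends_off_line /transverse /=.
move=> dis ru ru' rv rv' /and4P[z1 z2 z3 z4].
(* The corner [A - C] is off the plane of [u] and [v]; rescaled, it completes
   them to a basis of determinant 1. *)
pose e := (det3 u v (A - C))^-1 *: (A - C).
have e1 : det3 u v e = 1.
  by rewrite /e -[_ *: _]addr0 -(scale0r 0) det3_lin3 mul0r addr0 mulVf.
pose X w := det3 w v e; pose Y w := det3 u w e; pose Z w := det3 u v w.
pose V w : vec R := (X w, Y w, Z w).
have dec w : w = X w *: u + Y w *: v + Z w *: e by apply: cramer.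
have XYZ (x y : R) : [/\ X (x *: u + y *: v) = x, Y (x *: u + y *: v) = y &
    Z (x *: u + y *: v) = 0].
  split; rewrite /X /Y /Z ?det3_lin1 ?det3_lin2 ?det3_lin3.
  - by rewrite e1 (_ : det3 v v e = 0) ?mulr1 ?mulr0 ?addr0 // det3E; ring.
  - by rewrite e1 (_ : det3 u u e = 0) ?mulr1 ?mulr0 ?add0r // det3E; ring.
  - by rewrite !det3E; ring.
have pgramE s t : pgram (V (A - C)) (V (B - A)) (V (C - D)) s t =
   V (seg_point A B s - seg_point C D t).
  rewrite /pgram /V /cx /cy /cz /= /X /Y /Z !det3E /seg_point.
  by congr (_, _, _); rewrite !mxE; ring.
have addE w w' : vadd (V w) (V w') = V (w + w').
  by rewrite /vadd /V /cx /cy /cz /= /X /Y /Z !det3E; congr (_, _, _); rewrite !mxE; ring.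
have segC (a b : point) : seg_point a b 0 = a /\ seg_point a b 1 = b.
  by rewrite /seg_point subr0 subrr scale1r scale0r scale0r scale1r addr0 add0r.
have gp : general_position (V (A - C)) (V (B - A)) (V (C - D)).
  have q1 : A - C + (B - A) = B - C by rewrite addrC subrKA.
  have q2 : A - C + (C - D) = A - D by rewrite subrKA.
  have q3 : B - C + (C - D) = B - D by rewrite subrKA.
  split.
  - by rewrite !addE q1 q2 q3 /cz /= /Z z1 z2 z3 z4.
  - move=> s t hs ht bd; rewrite pgramE /cz /cx /cy /= => hz.
    have := dec (seg_point A B s - seg_point C D t).
    rewrite hz scale0r addr0.
    set x := X _; set y := Y _ => /eqP; rewrite subr_eq => /eqP dd.
    have off (p : point) (r : R) : seg_point A B s = r *: p + seg_point C D t ->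
       (p = u \/ p = v) -> False.
      move=> h hp.
      have offp : (forall r t, 0 <= t <= 1 -> A + r *: p <> seg_point C D t /\
             B + r *: p <> seg_point C D t) /\
          (forall r t, 0 <= t <= 1 -> C + r *: p <> seg_point A B t /\
             D + r *: p <> seg_point A B t) by case: hp => ->.
      have [o1 o2] := offp.
      have back (a b : point) : a = r *: p + b -> a + (- r) *: p = b.
        by move=> ->; rewrite scaleNr addrAC subrr add0r.
      have bwd (a b : point) : a = r *: p + b -> b + r *: p = a by rewrite addrC.
      case/or4P: bd => /eqP e0; move: h; rewrite e0.
      - by have [-> _] := segC A B => /back h; case: (o1 (- r) t ht).
      - by have [_ ->] := segC A B => /back h; case: (o1 (- r) t ht).
      - by have [-> _] := segC C D => /bwd h; case: (o2 r s hs).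
      - by have [_ ->] := segC C D => /bwd h; case: (o2 r s hs).
    split; apply/eqP => h0; move: dd; rewrite h0 scale0r ?addr0 ?add0r => dd.
      by apply: (off v y) => //; right.
    by apply: (off u x) => //; left.
  - move=> s t hs ht; rewrite pgramE => [[hx hy hz]].
    apply: (dis s t hs ht); apply/eqP; rewrite -subr_eq0; apply/eqP.
    by rewrite (dec (_ - _)) hx hy hz !scale0r !addr0.
have hitu : indic (meets_x (V (A - C)) (V (B - A)) (V (C - D))) =
    indic (passes_over u (A, B) (C, D)).
  apply: indic_eq => [[s [t [hs ht]]]|[s [t [r [hs ht r0 /= h]]]]].
    rewrite pgramE /cx /cy /cz /= => hy hz hx.
    exists s, t, (X (seg_point A B s - seg_point C D t)); split=> //=.
    have := dec (seg_point A B s - seg_point C D t).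
    by rewrite hy hz !scale0r !addr0 => <-; rewrite addrC subrK.
  exists s, t; rewrite pgramE /cx /cy /cz /=.
  rewrite h (addrC (seg_point C D t)) addrK -[r *: u]addr0 -(scale0r v).
  by have [-> -> ->] := XYZ r 0.
have hitv : indic (meets_y (V (A - C)) (V (B - A)) (V (C - D))) =
    indic (passes_over v (A, B) (C, D)).
  apply: indic_eq => [[s [t [hs ht]]]|[s [t [r [hs ht r0 /= h]]]]].
    rewrite pgramE /cx /cy /cz /= => hy hz hx.
    exists s, t, (Y (seg_point A B s - seg_point C D t)); split=> //=.
    have := dec (seg_point A B s - seg_point C D t).
    by rewrite hy hz !scale0r !addr0 add0r => <-; rewrite addrC subrK.
  exists s, t; rewrite pgramE /cx /cy /cz /=.
  rewrite h (addrC (seg_point C D t)) addrK -[r *: v]add0r -(scale0r u).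
  by have [-> -> ->] := XYZ 0 r.
have gE w w' : side_term (V w) (V w') = cone_term u v w w'.
  rewrite /side_term /side_jump /cone_term /cz /= -/(Z w) -/(Z w'); congr (_ * _).
  have lE (F : point -> R)
      (FE : forall a b (x y : R), F (x *: a + y *: b) = x * F a + y * F b) t :
     lin (F w) (F w') t = F (seg_point w w' t) by rewrite /lin /seg_point FE.
  have XE := lE X (fun a b x y => det3_lin1 v e a b x y).
  have YE := lE Y (fun a b x y => det3_lin2 u e a b x y).
  have ZE := lE Z (fun a b x y => det3_lin3 u v a b x y).
  apply: indic_eq => [[t]|[t [x [y [ht x0 y0 h]]]]]; rewrite /cx /cy /cz /=.
    move=> [ht hz hx hy]; exists t, (X (seg_point w w' t)), (Y (seg_point w w' t)).
    rewrite -XE -YE; split=> //.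
    by rewrite [LHS]dec -XE -YE -ZE hz scale0r addr0.
  by exists t; rewrite XE YE ZE h; have [-> -> ->] := XYZ x y.
have := parallelogram_sweep gp; rewrite /sweep_identity /boundary hitu hitv !addE !gE.
have q1 : A - C + (B - A) = B - C by rewrite addrC subrKA.
have q2 : A - C + (C - D) = A - D by rewrite subrKA.
have q3 : B - C + (C - D) = B - D by rewrite subrKA.
rewrite q1 q2 q3 => <-; rewrite /over_sign /orientation_sign /cx /cy /cz /=.
have gen (x y z x' y' z' : R) :
    (det3 (x *: u + y *: v + z *: e) (- (x' *: u + y' *: v + z' *: e)) u =
     - (y * z' - z * y') * det3 u v e) *
    (det3 (x *: u + y *: v + z *: e) (- (x' *: u + y' *: v + z' *: e)) v =
     - (z * x' - x * z') * det3 u v e).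
  by rewrite !det3E !mxE; split; ring.
have ou : det3 (B - A) (D - C) u = - (Y (B - A) * Z (C - D) - Z (B - A) * Y (C - D)).
  by rewrite -(opprB C D) {1}(dec (B - A)) {1}(dec (C - D)) gen e1 mulr1.
have ov : det3 (B - A) (D - C) v = - (Z (B - A) * X (C - D) - X (B - A) * Z (C - D)).
  by rewrite -(opprB C D) {1}(dec (B - A)) {1}(dec (C - D)) gen e1 mulr1.
by rewrite ou ov !sgzN; ring.
Qed.
End Vec.

(** * Directions in general position *)

Section Generic.
Variable R : realType.
Local Notation point := 'rV[R]_3.
Implicit Types u v w a b c e : point.

Lemma det3_eq0 a b c : det3 a b c = 0 ->
  exists x y z : R, (x, y, z) != (0, 0, 0) /\ x *: a + y *: b + z *: c = 0.
Proof.
move/eqP/det0P => [x x0 xM]; exists (x 0 i0), (x 0 i1), (x 0 i2); split.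
  apply: contraNneq x0 => [[h0 h1 h2]]; apply/eqP.
  by apply: point_eq; rewrite mxE.
rewrite -{}[RHS]xM mulmx_sum_row !big_ord_recl big_ord0 addr0 addrA.
rewrite (_ : lift ord0 (lift ord0 ord0) = i2); last exact: val_inj.
rewrite (_ : lift ord0 ord0 = i1); last exact: val_inj.
rewrite (_ : ord0 = i0); last exact: val_inj.
by congr (_ *: _ + _ *: _ + _ *: _); apply/rowP => j; rewrite !mxE.
Qed.

Lemma det3_neq0 u v w : u != 0 -> (forall r, w <> r *: u) ->
  (forall x y, v <> x *: u + y *: w) -> det3 u v w != 0.
Proof.
move=> u0 wu vuw; apply/eqP => /det3_eq0[x [y [z [n0 e0]]]].
have [y0|y0] := eqVneq y 0.
  move: e0; rewrite y0 scale0r addr0 => e0.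
  have [z0|z0] := eqVneq z 0.
    move: e0; rewrite z0 scale0r addr0 => /eqP; rewrite scaler_eq0 (negbTE u0) orbF.
    by move/eqP => x0; move: n0; rewrite x0 y0 z0 eqxx.
  apply: (wu (- x / z)); apply: (scalerI z0); rewrite scalerA mulrC divfK //.
  by apply/eqP; rewrite scaleNr -addr_eq0 addrC e0.
apply: (vuw (- x / y) (- z / y)); apply: (scalerI y0).
rewrite scalerDr !scalerA ![y * _]mulrC !divfK //.
apply/eqP; rewrite -subr_eq0 !scaleNr opprD !opprK -[X in _ == X]e0.
by rewrite addrCA addrA.
Qed.

Lemma nonroot (p : {poly R}) : p != 0 -> exists t, p.[t] != 0.
Proof.
move=> p0; apply: contrapT => h.
have rt t : root p t.
  by rewrite /root; apply: contrapT => /negP k; apply: h; exists t.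
have := @max_poly_roots _ p [seq i%:R | i <- iota 0 (size p)] p0.
have -> : all (root p) [seq i%:R | i <- iota 0 (size p)] by apply/allP => x _.
rewrite map_inj_uniq ?iota_uniq; last by move=> i j /eqP; rewrite eqr_nat => /eqP.
by rewrite size_map size_iota ltnn => /(_ isT isT).
Qed.

(** Any three points of the moment curve are independent, so a plane through
    the origin contains at most two of them. *)
Definition moment (t : R) : point := \row_(i < 3) t ^+ i.

(** The polynomial is the linear form given by a common normal [n] of [a] and
    [b], restricted to the moment curve.  Using [n] instead of the cross product
    covers dependent [a] and [b]. *)
Lemma avoid_span a b : exists2 p : {poly R}, p != 0 &
  forall t, p.[t] != 0 -> forall x y, moment t <> x *: a + y *: b.
Proof.
have : \det (\matrix_(i < 3) [:: a; b; 0]`_i)^T == 0.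
  rewrite det_tr -/(det3 a b 0) det3E !mxE; apply/eqP; ring.
case/det0P => n n0 nM.
have orth (c : point) (i : 'I_3) : [:: a; b; 0]`_i = c -> \sum_j n 0 j * c 0 j = 0.
  move=> <-; have /rowP/(_ i) := nM; rewrite !mxE => h; rewrite -[RHS]h.
  by apply: eq_bigr => j _; rewrite !mxE.
exists (\poly_(i < 3) n 0 (inord i)).
  apply: contraNneq n0 => p0; apply/eqP/rowP => j; rewrite mxE.
  have /(congr1 (fun q : {poly R} => q`_j)) := p0.
  by rewrite coef_poly coef0 ltn_ord inord_val.
move=> t + x y h; rewrite horner_poly => /eqP; apply.
transitivity (\sum_(j < 3) n 0 j * moment t 0 j).
  by apply: eq_bigr => i _; rewrite inord_val mxE.
rewrite h; transitivity (x * (\sum_j n 0 j * a 0 j) + y * (\sum_j n 0 j * b 0 j)).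
  rewrite !mulr_sumr -big_split /=; apply: eq_bigr => j _; rewrite !mxE; ring.
by rewrite (orth a i0) // (orth b i1) // !mulr0 addr0.
Qed.

Lemma avoid_spans (L : seq (point * point)) :
  exists v, forall d, d \in L -> forall x y, v <> x *: d.1 + y *: d.2.
Proof.
suff [p p0 hp] : exists2 p : {poly R}, p != 0 & forall t, p.[t] != 0 ->
    forall d, d \in L -> forall x y, moment t <> x *: d.1 + y *: d.2.
  by have [t ht] := nonroot p0; exists (moment t); apply: hp.
elim: L => [|d L [p p0 hp]]; first by exists 1; rewrite ?oner_eq0.
have [q q0 hq] := avoid_span d.1 d.2.
exists (q * p); first by rewrite mulf_neq0.
move=> t; rewrite hornerM mulf_eq0 negb_or => /andP[qt pt] d'.
by rewrite inE => /predU1P[->|]; [apply: hq|apply: hp].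
Qed.

(** Generic choice of a direction [v]: it avoids finitely many planes, among
    them those spanned by a given direction and a given vector. *)
Lemma pick_transverse (us ws : seq point) (L : seq (point * point)) :
  (forall u, u \in us -> u != 0 /\ forall w, w \in ws -> forall r, w <> r *: u) ->
  exists v, [/\ v != 0, forall d, d \in L -> forall x y, v <> x *: d.1 + y *: d.2
     & forall u w, u \in us -> w \in ws -> det3 u v w != 0].
Proof.
(* The degenerate plane of (0, 0) keeps [v] nonzero. *)
move=> h; have [v hv] := avoid_spans ((0, 0) :: L ++ [seq (u, w) | u <- us, w <- ws]).
exists v; split.
- apply/eqP => v0; apply: (hv (0, 0) _ 0 0); first by rewrite inE eqxx.
  by rewrite v0 !scaler0 addr0.
- by move=> d dL; apply: hv; rewrite inE mem_cat dL orbT.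
- move=> u w uu ww; have [u0 hu] := h u uu; apply: det3_neq0 => //; first exact: hu.
  move=> x y; apply: (hv (u, w)); rewrite inE mem_cat (allpairs_f (fun u w => (u, w))) //.
  by rewrite !orbT.
Qed.

(** * The linking number as a count of over-crossings *)

Lemma seg_point_onem a b (t : R) : seg_point b a (1 - t) = seg_point a b t.
Proof. by rewrite /seg_point subKr addrC. Qed.

Lemma cone_termC u v w w' : cone_term u v w' w = - cone_term u v w w'.
Proof.
rewrite /cone_term -mulNr opprB; congr (_ * _).
by apply: indic_eq => [] [t [x [y [ht x0 y0 h]]]]; exists (1 - t), x, y;
  rewrite onemI // seg_point_onem.
Qed.

Definition over_sum u (S S' : seq (point * point)) : int :=
  \sum_(ed <- S) \sum_(ed' <- S') over_sign u ed ed'.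

(** All that comparing two directions requires of a pair of edges, except for
    transversality. *)
Definition independent_edges u (ed ed' : point * point) :=
  [/\ disjoint_edges ed ed', ends_off_line u ed ed' & ends_off_line u ed' ed].

(** The side terms of all parallelograms, grouped so that each inner sum
    telescopes along one of the two polygonal lines. *)
Lemma over_sum_change u v (S S' : seq (point * point)) :
  (forall ed ed', ed \in S -> ed' \in S' ->
     [/\ independent_edges u ed ed', independent_edges v ed ed' & transverse u v ed ed']) ->
  over_sum v S S' - over_sum u S S' =
  \sum_(ed <- S) \sum_(ed' <- S')
     (cone_term u v (ed.1 - ed'.1) (ed.2 - ed'.1)
      - cone_term u v (ed.1 - ed'.2) (ed.2 - ed'.2)) +
  \sum_(ed' <- S') \sum_(ed <- S)
     (cone_term u v (ed.2 - ed'.1) (ed.2 - ed'.2)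
      - cone_term u v (ed.1 - ed'.1) (ed.1 - ed'.2)).
Proof.
move=> h; rewrite [X in _ = _ + X]exchange_big -big_split /over_sum -sumrB /=.
apply: eq_big_seq => ed hed; rewrite -big_split -sumrB /=.
apply: eq_big_seq => ed' hed'.
have [[dis u1 u2] [_ v1 v2] tr] := h _ _ hed hed'.
rewrite over_sign_change // (cone_termC _ _ (ed.1 - ed'.2) (ed.2 - ed'.2)).
by rewrite (cone_termC _ _ (ed.1 - ed'.1) (ed.1 - ed'.2)); ring.
Qed.

Lemma polygon_telescope (P : seq point) (F : point -> int) :
  \sum_(ed <- polygon_edges P) (F ed.2 - F ed.1) = 0.
Proof.
rewrite sumrB /polygon_edges.
have sz : size (rot 1 P) = size P by rewrite size_rot.
rewrite -(big_map snd xpredT F) -(big_map fst xpredT F) /=.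
rewrite -/unzip1 -/unzip2 unzip1_zip ?unzip2_zip ?sz //.
by rewrite (perm_big P) ?subrr //= perm_rot.
Qed.

Lemma mem_polygon_edges (P : seq point) ed :
  ed \in polygon_edges P -> ed.1 \in P /\ ed.2 \in P.
Proof.
rewrite /polygon_edges => h; have sz : size (rot 1 P) = size P by rewrite size_rot.
split.
  have : ed.1 \in unzip1 (zip P (rot 1 P)) by apply: map_f.
  by rewrite unzip1_zip ?sz.
have : ed.2 \in unzip2 (zip P (rot 1 P)) by apply: map_f.
by rewrite unzip2_zip ?sz // mem_rot.
Qed.

Definition disjoint_polygons (P Q : seq point) :=
  forall ed ed', ed \in polygon_edges P -> ed' \in polygon_edges Q ->
  disjoint_edges ed ed'.

Lemma regular_independent P Q u ed ed' : disjoint_polygons P Q ->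
  regular_direction P Q u -> ed \in polygon_edges P -> ed' \in polygon_edges Q ->
  independent_edges u ed ed'.
Proof.
move=> dis [u0 h1 h2] hed hed'; split; first exact: dis.
  have [m1 m2] := mem_polygon_edges hed.
  by move=> r t ht; split; [apply: h1|apply: h1].
have [m1 m2] := mem_polygon_edges hed'.
by move=> r t ht; split; [apply: h2|apply: h2].
Qed.

Definition polygon_over_sum u P Q := over_sum u (polygon_edges P) (polygon_edges Q).

(** Both groups of [over_sum_change] telescope around a closed polygon. *)
Lemma over_sum_closed P Q u v : disjoint_polygons P Q ->
  regular_direction P Q u -> regular_direction P Q v ->
  (forall a b, a \in P -> b \in Q -> det3 u v (a - b) != 0) ->
  polygon_over_sum v P Q = polygon_over_sum u P Q.
Proof.
move=> dis ru rv tr; apply/eqP; rewrite -subr_eq0; apply/eqP.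
rewrite /polygon_over_sum over_sum_change; last first.
  move=> ed ed' hed hed'; split; try exact: regular_independent hed hed'.
  have [m1 m2] := mem_polygon_edges hed; have [m1' m2'] := mem_polygon_edges hed'.
  by rewrite /transverse !tr.
rewrite [X in X + _]big1 ?[X in _ + X]big1 ?addr0 //.
  move=> ed' _.
  exact: (polygon_telescope P (fun a => cone_term u v (a - ed'.1) (a - ed'.2))).
move=> ed _; have := polygon_telescope Q (fun c => cone_term u v (ed.1 - c) (ed.2 - c)).
move/eqP; rewrite -oppr_eq0 -sumrN => /eqP h; rewrite -[RHS]h.
by apply: eq_bigr => ed' _; rewrite opprB.
Qed.

(** A point [a] seen along [u] on the edge [ed] puts [u] in the plane through
    [a] and [ed]. *)
Lemma span_off a (ed : point * point) u :
  (forall x y, u <> x *: (ed.1 - a) + y *: (ed.2 - a)) ->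
  (forall t, 0 <= t <= 1 -> a <> seg_point ed.1 ed.2 t) ->
  forall r t, 0 <= t <= 1 -> a + r *: u <> seg_point ed.1 ed.2 t.
Proof.
move=> hu ha r t ht h.
have e : r *: u = (1 - t) *: (ed.1 - a) + t *: (ed.2 - a).
  rewrite !scalerBr addrACA -opprD -scalerDl subrK scale1r -/(seg_point ed.1 ed.2 t) -h.
  by rewrite addrC addKr.
have [r0|r0] := eqVneq r 0; first by apply: (ha t ht); rewrite -h r0 scale0r addr0.
apply: (hu ((1 - t) / r) (t / r)); apply: (scalerI r0).
by rewrite e [RHS]scalerDr !scalerA ![r * _]mulrC !divfK.
Qed.

Lemma seg_point0 a b : seg_point a b (0 : R) = a.
Proof. by rewrite /seg_point subr0 scale1r scale0r addr0. Qed.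
Lemma seg_point1 a b : seg_point a b (1 : R) = b.
Proof. by rewrite /seg_point subrr scale1r scale0r add0r. Qed.

Lemma disjoint_edgesC (ed ed' : point * point) :
  disjoint_edges ed ed' -> disjoint_edges ed' ed.
Proof. by move=> h s t hs ht e; apply: (h t s ht hs). Qed.

Lemma independent_edgesC u (ed ed' : point * point) :
  independent_edges u ed ed' -> independent_edges u ed' ed.
Proof. by move=> [h1 h2 h3]; split=> //; apply: disjoint_edgesC. Qed.

Definition span_list (W : seq point) : seq (point * point) :=
  [seq (bc.1 - a, bc.2 - a) | a <- W, bc <- [seq (x, y) | x <- W, y <- W]].

Lemma span_independent (W : seq point) u (ed ed' : point * point) :
  (forall d, d \in span_list W -> forall x y, u <> x *: d.1 + y *: d.2) ->
  ed.1 \in W -> ed.2 \in W -> ed'.1 \in W -> ed'.2 \in W ->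
  disjoint_edges ed ed' -> independent_edges u ed ed'.
Proof.
move=> hu.
have mem a b c : a \in W -> b \in W -> c \in W -> (b - a, c - a) \in span_list W.
  move=> aW bW cW.
  apply: (@allpairs_f _ _ _ (fun a bc => (bc.1 - a, bc.2 - a)) W _ a (b, c)) => //.
  by apply: (@allpairs_f _ _ _ (fun x y => (x, y))).
suff half ed1 ed2 : ed1.1 \in W -> ed1.2 \in W -> ed2.1 \in W -> ed2.2 \in W ->
    disjoint_edges ed1 ed2 -> ends_off_line u ed1 ed2.
  by move=> *; split=> //; apply: half => //; apply: disjoint_edgesC.
move=> m1 m2 m3 m4 dis r t ht; split; apply: span_off => //.
- by move=> x y; apply: (hu _ (mem ed1.1 ed2.1 ed2.2 _ _ _)).
- move=> t' ht' e; apply: (dis 0 t') => //; first by rewrite lexx ler01.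
  by rewrite seg_point0.
- by move=> x y; apply: (hu _ (mem ed1.2 ed2.1 ed2.2 _ _ _)).
- move=> t' ht' e; apply: (dis 1 t') => //; first by rewrite lexx ler01.
  by rewrite seg_point1.
Qed.

Lemma mem_edge_of (P : seq point) a : a \in P ->
  exists2 ed, ed \in polygon_edges P & ed.1 = a.
Proof.
have sz : size (rot 1 P) = size P by rewrite size_rot.
rewrite -{1}(@unzip1_zip _ _ P (rot 1 P)) ?sz // => /mapP[ed h ->].
by exists ed.
Qed.

Lemma independent_regular P Q u : u != 0 ->
  (forall ed ed', ed \in polygon_edges P -> ed' \in polygon_edges Q ->
     independent_edges u ed ed') -> regular_direction P Q u.
Proof.
move=> u0 ind; split=> // a ed hP hed r t ht.
  have [ed1 hed1 <-] := mem_edge_of hP.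
  by have [_ h _] := ind _ _ hed1 hed; have [] := h r t ht.
have [ed1 hed1 <-] := mem_edge_of hP.
by have [_ _ h] := ind _ _ hed hed1; have [] := h r t ht.
Qed.

Lemma span_regular P Q u : u != 0 -> disjoint_polygons P Q ->
  (forall d, d \in span_list (P ++ Q) -> forall x y, u <> x *: d.1 + y *: d.2) ->
  regular_direction P Q u.
Proof.
move=> u0 dis hu; apply: independent_regular => // ed ed' hed hed'.
have [m1 m2] := mem_polygon_edges hed; have [m1' m2'] := mem_polygon_edges hed'.
by apply: (span_independent hu); rewrite ?mem_cat ?m1 ?m2 ?m1' ?m2' ?orbT //; apply: dis.
Qed.

(** The given directions may be in special position to each other, or opposite;
    both are compared with a third one that is transverse to the two. *)
Lemma over_sum_invariant P Q u u' : disjoint_polygons P Q ->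
  regular_direction P Q u -> regular_direction P Q u' ->
  polygon_over_sum u P Q = polygon_over_sum u' P Q.
Proof.
move=> dis ru ru'.
have indep x : regular_direction P Q x -> forall w, w \in [seq a - b | a <- P, b <- Q] ->
    forall r, w <> r *: x.
  move=> rx w /allpairsP[[a b] /= [aP bQ ->]] r h.
  have [ed hed ea] := mem_edge_of aP; have [ed' hed' eb] := mem_edge_of bQ.
  have [_ k _] := regular_independent dis rx hed hed'.
  have /(k (- r))[] : 0 <= (0 : R) <= 1 by rewrite lexx ler01.
  by rewrite seg_point0 ea eb scaleNr -h opprB addrC subrK.
have [|v [v0 hv tr]] := @pick_transverse [:: u; u']
    [seq a - b | a <- P, b <- Q] (span_list (P ++ Q)).
  move=> x; rewrite !inE => /orP[] /eqP ->.
    by split; [case: ru|apply: indep].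
  by split; [case: ru'|apply: indep].
have rv := span_regular v0 dis hv.
transitivity (polygon_over_sum v P Q).
  apply/esym/over_sum_closed => // a b aP bQ; apply: tr; first by rewrite inE eqxx.
  by apply: (@allpairs_f _ _ _ (fun a b => a - b)).
apply/over_sum_closed => // a b aP bQ; apply: tr; first by rewrite !inE eqxx orbT.
by apply: (@allpairs_f _ _ _ (fun a b => a - b)).
Qed.

Lemma passes_over_opp u ed ed' : passes_over (- u) ed ed' <-> passes_over u ed' ed.
Proof.
split=> [] [s [t [r [hs ht r0 h]]]]; exists t, s, r; split=> //.
  by rewrite h scalerN subrK.
by rewrite h scalerN addrK.
Qed.

Lemma orientation_sign_opp u ed ed' :
  orientation_sign (- u) ed ed' = orientation_sign u ed' ed.
Proof. by rewrite /orientation_sign; congr sgz; rewrite !det3E !mxE; ring. Qed.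

(** Looking from the opposite side exchanges over and under but preserves the
    sign of the crossing. *)
Lemma over_sign_opp u ed ed' : over_sign (- u) ed ed' = over_sign u ed' ed.
Proof.
by rewrite /over_sign orientation_sign_opp (indic_iff (passes_over_opp u ed ed')).
Qed.

(** If each edge passes over the other, then [u] is parallel to the plane of the
    two edges and both signs are zero. *)
Lemma crossing_signE u ed ed' :
  crossing_sign u ed ed' = over_sign u ed ed' + over_sign (- u) ed ed'.
Proof.
rewrite over_sign_opp /crossing_sign /over_sign.
case: (asboolP (passes_over u ed ed')) => h1;
  case: (asboolP (passes_over u ed' ed)) => h2.
- suff d0 : det3 (ed.2 - ed.1) (ed'.2 - ed'.1) u = 0.
    rewrite /orientation_sign d0.
    have -> : det3 (ed'.2 - ed'.1) (ed.2 - ed.1) u = 0.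
      by rewrite -[RHS]oppr0 -d0 !det3E; ring.
    by rewrite sgz0 !mul0r.
  have [s [t [r [_ _ r0 e1]]]] := h1; have [s' [t' [r' [_ _ r0' e2]]]] := h2.
  have rr : r + r' != 0 by rewrite gt_eqF // addr_gt0.
  have e : (r + r') *: u = (s - t') *: (ed.2 - ed.1) - (t - s') *: (ed'.2 - ed'.1).
    have e1' : r *: u = seg_point ed.1 ed.2 s - seg_point ed'.1 ed'.2 t.
      by rewrite e1 addrC addKr.
    have e2' : r' *: u = seg_point ed'.1 ed'.2 s' - seg_point ed.1 ed.2 t'.
      by rewrite e2 addrC addKr.
    rewrite scalerDl e1' e2' /seg_point; apply: point_eq; rewrite !mxE; ring.
  have : (r + r') * det3 (ed.2 - ed.1) (ed'.2 - ed'.1) u = 0.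
    transitivity (det3 (ed.2 - ed.1) (ed'.2 - ed'.1) ((r + r') *: u)).
      by rewrite !det3E !mxE; ring.
    by rewrite e !det3E !mxE; ring.
  by move/eqP; rewrite mulf_eq0 (negbTE rr) => /eqP.
- by rewrite (indicT h1) (indicF h2) mulr1 mulr0 addr0.
- by rewrite (indicT h2) (indicF h1) mulr1 mulr0 add0r.
- by rewrite (indicF h1) (indicF h2) !mulr0 addr0.
Qed.

Lemma crossing_sumE u P Q :
  crossing_sum u P Q = polygon_over_sum u P Q + polygon_over_sum (- u) P Q.
Proof.
rewrite /crossing_sum /polygon_over_sum /over_sum -big_split; apply: eq_bigr => ed _.
by rewrite -big_split; apply: eq_bigr => ed' _; apply: crossing_signE.
Qed.

Lemma regular_opp P Q u : regular_direction P Q u -> regular_direction P Q (- u).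
Proof.
move=> [u0 h1 h2]; split; first by rewrite oppr_eq0.
  by move=> a ed ha hed r t ht; rewrite scalerN -scaleNr; apply: h1.
by move=> a ed ha hed r t ht; rewrite scalerN -scaleNr; apply: h2.
Qed.

(** The counts for [u] and for [- u], whose mean is the linking number, are
    equal by invariance. *)
Lemma linking_numberE P Q u : disjoint_polygons P Q -> regular_direction P Q u ->
  linking_number P Q = (polygon_over_sum u P Q)%:~R.
Proof.
move=> dis ru; rewrite /linking_number.
have rx : regular_direction P Q (xget 0 (regular_direction P Q)).
  by apply: (xgetPex 0); exists u.
rewrite crossing_sumE (over_sum_invariant dis (regular_opp rx) ru).
rewrite (over_sum_invariant dis rx ru) intrD -mulr2n -[_ *+ 2]mulr_natr.
by rewrite mulfK.
Qed.

End Generic.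

(** * The arcs of a spatial graph *)

Section Arcs.
Variable R : realType.
Local Notation point := 'rV[R]_3.

Definition path_edges (s : seq point) : seq (point * point) := zip s (behead s).

Lemma path_edges_cons a b s : path_edges (a :: b :: s) = (a, b) :: path_edges (b :: s).
Proof. by []. Qed.

Lemma path_edges_cat a s b s' :
  path_edges ((a :: s) ++ b :: s') = path_edges (a :: rcons s b) ++ path_edges (b :: s').
Proof. by elim: s a => [|c s IH] a //=; rewrite path_edges_cons -cat_cons IH. Qed.

Lemma path_edges_rcons a s b c :
  path_edges (rcons (a :: rcons s b) c) = rcons (path_edges (a :: rcons s b)) (b, c).
Proof. by elim: s a => [|d s IH] a //=; rewrite !path_edges_cons /= -IH. Qed.

Lemma path_edges_rev s :
  path_edges (rev s) = rev [seq (ed.2, ed.1) | ed <- path_edges s].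
Proof.
case: s => // a s; elim: s a => // b s IH a.
rewrite path_edges_cons map_cons [RHS]rev_cons -IH !rev_cons /=.
by case: (rev s) => [|c s'] //=; rewrite -rcons_cons path_edges_rcons.
Qed.

Lemma mem_path_edges s ed : ed \in path_edges s -> exists k,
  [/\ (k.+1 < size s)%N, ed.1 = s`_k & ed.2 = s`_k.+1].
Proof.
move=> /(nthP (0, 0))[k]; rewrite size_zip size_behead => hk <-.
exists k; split; first by case: s hk => //= a s; rewrite leq_min => /andP[_].
  by rewrite nth_zip_cond size_zip size_behead hk.
by rewrite nth_zip_cond size_zip size_behead hk /= nth_behead.
Qed.

Lemma path_telescope (s : seq point) a b (F : point -> int) :
  \sum_(ed <- path_edges (a :: rcons s b)) (F ed.2 - F ed.1) = F b - F a.
Proof.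
elim: s a => [|c s IH] a; first by rewrite /path_edges /= big_seq1.
by rewrite rcons_cons path_edges_cons big_cons IH /= addrC subrKA.
Qed.

Lemma path_telescope_xor (s : seq point) a b (F : point -> bool) :
  \big[addb/false]_(ed <- path_edges (a :: rcons s b)) (F ed.1 (+) F ed.2) = F a (+) F b.
Proof.
elim: s a => [|c s IH] a; first by rewrite /path_edges /= big_seq1.
by rewrite rcons_cons path_edges_cons big_cons IH /= -addbA addKb.
Qed.

Lemma polyline_edge s k (t : R) : 0 <= t <= 1 -> (k.+1 < size s)%N ->
  seg_point s`_k s`_k.+1 t = polyline s (k%:R + t).
Proof.
move=> /andP[t0 t1] hk; rewrite /polyline.
have [t1'|t1'] := ltP t 1.
  have -> : Num.truncn (k%:R + t) = k.
    by apply: truncn_def; rewrite lerDl t0 -natr1 ltrD2l.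
  by rewrite addrAC subrr add0r.
(* At [t = 1] the polyline is already at the start of its next piece. *)
have -> : t = 1 by apply/eqP; rewrite eq_le t1 t1'.
by rewrite natr1 natrK subrr seg_point0 seg_point1.
Qed.

Variables (V : finType) (e : rel V) (f : spatial_embedding R e).
Implicit Types x y z w : V.

Definition edge_arc x y := arc_path (pos f) (bends f) x y.
Definition arc_edges x y := path_edges (edge_arc x y).
Definition arc_len x y : R := arc_length (bends f) x y.

Lemma arc_polyline x y ed t : ed \in arc_edges x y -> 0 <= t <= 1 ->
  exists2 tau, 0 <= tau <= arc_len x y & seg_point ed.1 ed.2 t = polyline (edge_arc x y) tau.
Proof.
move=> /mem_path_edges[k [hk -> ->]] ht; exists (k%:R + t); last exact: polyline_edge.
case/andP: ht => t0 t1; rewrite addr_ge0 //= /arc_len /arc_length.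
rewrite /edge_arc /arc_path /= size_rcons !ltnS in hk.
by rewrite -natr1 lerD // ler_nat.
Qed.

Lemma polyline_start x y : polyline (edge_arc x y) 0 = pos f x.
Proof. by rewrite /polyline -[X in Num.truncn X]/(0%:R) natrK subrr seg_point0. Qed.

Lemma polyline_end x y : polyline (edge_arc x y) (arc_len x y) = pos f y.
Proof.
rewrite /polyline /arc_len /arc_length natrK subrr seg_point0 /edge_arc /arc_path /=.
by rewrite nth_rcons ltnn eqxx.
Qed.

Lemma arc_point x y tau : 0 <= tau <= arc_len x y ->
  [\/ polyline (edge_arc x y) tau = pos f x, polyline (edge_arc x y) tau = pos f y |
      0 < tau < arc_len x y].
Proof.
move=> /andP[t0 t1]; have [<-|t0'] := eqVneq 0 tau.
  by rewrite polyline_start; constructor 1.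
have [->|t1'] := eqVneq tau (arc_len x y); first by rewrite polyline_end; constructor 2.
by constructor 3; rewrite !lt_neqAle t0 t1 t0' t1'.
Qed.

(** Points of two arcs are compared according to whether they are end points or
    interior; each combination is excluded by one field of the embedding. *)
Lemma arcs_disjoint x y z w ed ed' : e x y -> e z w ->
  x != z -> x != w -> y != z -> y != w ->
  ed \in arc_edges x y -> ed' \in arc_edges z w -> disjoint_edges ed ed'.
Proof.
move=> exy ezw xz xw yz yw hed hed' s t hs ht.
have [tau h1 ->] := arc_polyline hed hs; have [tau' h2 ->] := arc_polyline hed' ht.
have vx a b c d : e a b -> a != c -> b != c -> 0 <= d <= arc_len a b ->
    polyline (edge_arc a b) d <> pos f c.
  move=> eab ac bc hd; case: (arc_point hd) => [->|->|h].
  - by move/(@pos_inj _ _ _ f)=> h; rewrite h eqxx in ac.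
  - by move/(@pos_inj _ _ _ f)=> h; rewrite h eqxx in bc.
  - exact: edge_avoids_vertices.
case: (arc_point h2) => [->|->|h2']; [exact: vx|exact: vx|].
case: (arc_point h1) => [->|->|h1'].
- by move/esym; apply: vx => //; rewrite eq_sym.
- by move/esym; apply: vx => //; rewrite eq_sym.
- by case/(edge_inj exy ezw h1' h2') => [] [h _ _];
    [rewrite h eqxx in xz|rewrite h eqxx in xw].
Qed.

Lemma arc_rev x y : e x y -> edge_arc y x = rev (edge_arc x y).
Proof.
move=> exy; rewrite /edge_arc /arc_path (bends_rev f exy).
by rewrite rev_cons rev_rcons rcons_cons.
Qed.

Lemma arc_edges_rev x y : e x y ->
  arc_edges y x = rev [seq (ed.2, ed.1) | ed <- arc_edges x y].
Proof. by move=> exy; rewrite /arc_edges arc_rev // path_edges_rev. Qed.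

Lemma over_signNl u (ed ed' : point * point) :
  over_sign u (ed.2, ed.1) ed' = - over_sign u ed ed'.
Proof.
rewrite /over_sign -mulNr; congr (_ * _).
  by rewrite /orientation_sign -sgzN; congr sgz; rewrite /= !det3E !mxE; ring.
apply: indic_eq => [] [s [t [r [hs ht r0 /= h]]]]; exists (1 - s), t, r;
  by rewrite onemI //= seg_point_onem.
Qed.

Lemma over_sum_arcNl u x y (S : seq (point * point)) : e x y ->
  over_sum u (arc_edges y x) S = - over_sum u (arc_edges x y) S.
Proof.
move=> exy; rewrite arc_edges_rev // /over_sum (perm_big _ (permEl (perm_rev _))).
rewrite big_map -sumrN; apply: eq_bigr => ed _; rewrite -sumrN.
by apply: eq_bigr => ed' _; apply: over_signNl.
Qed.

Lemma over_sum_opp u (S S' : seq (point * point)) :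
  over_sum (- u) S S' = over_sum u S' S.
Proof.
rewrite /over_sum exchange_big /=; apply: eq_bigr => ed _; apply: eq_bigr => ed' _.
exact: over_sign_opp.
Qed.

Lemma over_sum_arcNr u x y (S : seq (point * point)) : e x y ->
  over_sum u S (arc_edges y x) = - over_sum u S (arc_edges x y).
Proof. by move=> exy; rewrite -[LHS]over_sum_opp over_sum_arcNl // over_sum_opp. Qed.

Lemma map_next (T : eqType) (c : seq T) : uniq c -> [seq next c a | a <- c] = rot 1 c.
Proof.
move=> uc; case: c uc => [|x0 c] // uc.
apply: (@eq_from_nth _ x0); first by rewrite size_map size_rot.
move=> i; rewrite size_map => hi; rewrite (nth_map x0) //.
by rewrite next_nth mem_nth // index_uniq // rot1_cons nth_rcons if_same;
  case: ltnP => // h; rewrite nth_default.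
Qed.

(** The closed polygon of a cycle, cut open at its first vertex, is the
    concatenation of the arcs; induction needs a free last vertex [z]. *)
Lemma chain_edges x s z :
  path_edges (rcons (flatten [seq pos f p.1 :: bends f p.1 p.2 |
      p <- zip (x :: s) (rcons s z)]) (pos f z)) =
  flatten [seq arc_edges p.1 p.2 | p <- zip (x :: s) (rcons s z)].
Proof.
elim: s x => [|y s IH] x; first by rewrite /= !cats0.
rewrite rcons_cons /= -IH rcons_cat; case: s {IH} => [|y' s] /=.
  by rewrite -!cat_cons path_edges_cat.
by rewrite -!cat_cons path_edges_cat.
Qed.

Lemma cycle_image_edges (c : seq V) : uniq c ->
  polygon_edges (cycle_image f c) = flatten [seq arc_edges x (next c x) | x <- c].
Proof.
case: c => [|x s] // uc.
have pairs (T : Type) (F : V -> V -> T) :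
    [seq F y (next (x :: s) y) | y <- x :: s] =
    [seq F p.1 p.2 | p <- zip (x :: s) (rcons s x)].
  rewrite -rot1_cons -map_next //.
  by move: (next _) => N; elim: (x :: s) => //= y t ->.
rewrite (pairs _ arc_edges) /cycle_image (pairs _ (fun y z => pos f y :: bends f y z)).
rewrite -chain_edges /polygon_edges /path_edges.
have [P ->] : exists P, flatten [seq pos f p.1 :: bends f p.1 p.2 |
    p <- zip (x :: s) (rcons s x)] = pos f x :: P.
  by case: s {uc pairs} => [|y s] /=; eexists.
rewrite rot1_cons /= -[X in _ = zip _ X]cats0 -cats1 -cat_cons.
by rewrite zip_cat ?cats0 //= cats1 size_rcons.
Qed.

Lemma mem_cycle_edges (c : seq V) ed : uniq c -> ed \in polygon_edges (cycle_image f c) ->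
  exists2 x, x \in c & ed \in arc_edges x (next c x).
Proof. by move=> uc; rewrite cycle_image_edges // => /flatten_mapP. Qed.

Lemma over_sum_cycles u c c' : uniq c -> uniq c' ->
  polygon_over_sum u (cycle_image f c) (cycle_image f c') =
  \sum_(x <- c) \sum_(y <- c') over_sum u (arc_edges x (next c x)) (arc_edges y (next c' y)).
Proof.
move=> uc uc'; rewrite /polygon_over_sum /over_sum !cycle_image_edges //.
rewrite big_flatten big_map; apply: eq_bigr => x _.
under eq_bigr do rewrite big_flatten big_map.
by rewrite exchange_big.
Qed.

Definition arc_points : seq point :=
  flatten [seq edge_arc p.1 p.2 | p <- [seq (x, y) | x <- enum V, y <- enum V]].

Lemma arc_points_edge x y ed : ed \in arc_edges x y ->
  ed.1 \in arc_points /\ ed.2 \in arc_points.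
Proof.
have sub a : a \in edge_arc x y -> a \in arc_points.
  move=> h; apply/flatten_mapP; exists (x, y) => //.
  by apply: (@allpairs_f _ _ _ (fun x y => (x, y))); rewrite mem_enum.
move=> /mem_path_edges[k [hk e1 e2]]; split; apply: sub; rewrite ?e1 ?e2 mem_nth //.
exact: ltnW.
Qed.

(** General position with respect to the whole graph at once, so that one
    direction serves all pairs of cycles. *)
Definition generic u := u != 0 /\
  forall d, d \in span_list arc_points -> forall s t : R, u <> s *: d.1 + t *: d.2.

Lemma generic_pair : exists u v, [/\ generic u, generic v &
  forall a b, a \in arc_points -> b \in arc_points -> a != b -> det3 u v (a - b) != 0].
Proof.
have [|u [u0 hu _]] := @pick_transverse R [::] [::] (span_list arc_points); first by [].
pose ws := [seq p.1 - p.2 | p <- [seq (a, b) | a <- arc_points, b <- arc_points] & p.1 != p.2].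
have mem a b : a \in arc_points -> b \in arc_points -> a != b -> a - b \in ws.
  move=> aW bW ab; apply/mapP; exists (a, b) => //; rewrite mem_filter ab /=.
  by apply: (@allpairs_f _ _ _ (fun a b => (a, b))).
have [|v [v0 hv tr]] := @pick_transverse R [:: u] ws (span_list arc_points).
  move=> x; rewrite inE => /eqP ->; split=> // w /mapP[p].
  rewrite mem_filter => /andP[ne /allpairsP[[a b] /= [aW bW ep]]] -> r h.
  rewrite ep /= in ne h.
  have r0 : r != 0.
    apply: contraNneq ne => r0.
    by move: h; rewrite r0 scale0r => /eqP; rewrite subr_eq0.
  (* The plane of the triple (b, a, a) degenerates to the line of [a - b]. *)
  apply: (hu (a - b, a - b) _ r^-1 0).
    apply: (@allpairs_f _ _ _ (fun a bc => (bc.1 - a, bc.2 - a)) _ _ b (a, a)) => //.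
    exact: (@allpairs_f _ _ _ (fun a b => (a, b))).
  by rewrite /= h scale0r addr0 scalerA mulVf // scale1r.
exists u, v; split=> // a b aW bW ab; apply: tr; rewrite ?inE //; exact: mem.
Qed.

Hypothesis complete : forall x y, e x y = (x != y).

Lemma generic_independent u x y z w ed ed' : generic u ->
  uniq [:: x; y; z; w] -> ed \in arc_edges x y -> ed' \in arc_edges z w ->
  independent_edges u ed ed'.
Proof.
rewrite /= !inE !negb_or !andbT -!andbA => [[_ hu]] /and5P[xy xz xw yz /andP[yw zw]] hed hed'.
have [m1 m2] := arc_points_edge hed; have [m1' m2'] := arc_points_edge hed'.
by apply: (span_independent hu) => //; apply: arcs_disjoint hed hed' => //; rewrite complete.
Qed.

Lemma linking_number_arcs u p q c c' : generic u ->
  Gamma e p q (c, c') ->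
  linking_number (cycle_image f c) (cycle_image f c') =
  (\sum_(x <- c) \sum_(y <- c')
     over_sum u (arc_edges x (next c x)) (arc_edges y (next c' y)))%:~R.
Proof.
move=> gu [/= [_ sc /andP[cc uc]] [_ sc' /andP[cc' uc']] dis].
have nx (d : seq V) x : cycle e d -> x \in d -> x != next d x.
  by move=> cd xd; rewrite -complete next_cycle.
have ind ed ed' : ed \in polygon_edges (cycle_image f c) ->
    ed' \in polygon_edges (cycle_image f c') -> independent_edges u ed ed'.
  move=> /(mem_cycle_edges uc)[x xc hed] /(mem_cycle_edges uc')[y yc hed'].
  apply: generic_independent hed hed' => //.
  have ne a b : a \in c -> b \in c' -> a != b.
    by move=> ac bc; apply: contraNneq dis => ab; apply/hasP; exists b => //; rewrite /= -ab.
  rewrite /= !inE !negb_or (nx c) // (nx c') // (ne x y) // (ne x (next c' y)) //.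
  - by rewrite (ne _ y) ?(ne _ (next c' y)) ?mem_next.
  - by rewrite mem_next.
rewrite (@linking_numberE _ _ _ u).
- by rewrite over_sum_cycles.
- by move=> ed ed' hed hed'; case: (ind _ _ hed hed').
- by apply: independent_regular => //; case: gu.
Qed.

Definition parity (n : int) := odd `|n|%N.

Lemma parityD m n : parity (m + n) = parity m (+) parity n.
Proof. rewrite /parity; lia. Qed.
Lemma parityN m : parity (- m) = parity m.
Proof. by rewrite /parity abszN. Qed.
Lemma parityM m n : parity (m * n) = parity m && parity n.
Proof. by rewrite /parity abszM oddM. Qed.
Lemma parity_sum (I : Type) (s : seq I) (F : I -> int) :
  parity (\sum_(i <- s) F i) = \big[addb/false]_(i <- s) parity (F i).
Proof. exact: (big_morph parity parityD). Qed.

End Arcs.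

(** * Parity of the crossings of two arcs *)

Section Parity.
Variable R : realType.
Local Notation point := 'rV[R]_3.
Implicit Types (u v w a b c : point).

(** The sectors from [u] to [v] and from [v] to [- u] make up the half-plane of
    [v]; thus this is the signed crossing of a segment with a vertical half-plane
    when [u] is the line of sight and [v] points upwards. *)
Definition half_term u v w w' : int := cone_term u v w w' + cone_term v (- u) w w'.

Lemma parity_indic (P : Prop) : parity (indic P) = `[< P >].
Proof. by rewrite /indic /parity; case: asbool. Qed.

Lemma parity_bits (b b' : bool) : parity ((b : nat)%:Z - (b' : nat)%:Z) = b (+) b'.
Proof. by case: b; case: b'. Qed.

Lemma parity_cone u v w w' : parity (cone_term u v w w') =
  ((0 < det3 u v w') (+) (0 < det3 u v w)) && `[< meets_cone u v w w' >].
Proof. by rewrite /cone_term parityM parity_bits parity_indic. Qed.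

Lemma det3_quarter u v w : det3 v (- u) w = det3 u v w.
Proof. by rewrite !det3E !mxE; ring. Qed.

Lemma det3N u v w : det3 u v (- w) = - det3 u v w.
Proof. by rewrite !det3E !mxE; ring. Qed.

Lemma seg_pointN w w' (t : R) : seg_point (- w) (- w') t = - seg_point w w' t.
Proof. by rewrite /seg_point !scalerN opprD. Qed.

Lemma det3_seg u v w w' (t : R) :
  det3 u v (seg_point w w' t) = lin (det3 u v w) (det3 u v w') t.
Proof. by rewrite /seg_point det3_lin3. Qed.

(** The coefficients are unique because [det3 u v] changes sign along the
    segment, which fixes [t], and because [u] and [v] are independent. *)
Lemma plane_crossing u v w w' : det3 u v w != 0 -> det3 u v w' != 0 ->
  (0 < det3 u v w') != (0 < det3 u v w) ->
  exists t x y : R, [/\ 0 <= t <= 1, seg_point w w' t = x *: u + y *: v &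
    forall t' x' y', seg_point w w' t' = x' *: u + y' *: v -> x' = x /\ y' = y].
Proof.
move=> z0 z1 ne; set z := det3 u v w in z0 ne *; set z' := det3 u v w' in z1 ne *.
have := @zero_between R z (z' - z) z0; rewrite addrC subrK eq_sym => /(_ ne)[d0 /(_ z1) ht].
set t := - z / (z' - z) in ht.
have zt : det3 u v (seg_point w w' t) = 0.
  by rewrite det3_seg -/z -/z' /lin /t; field.
pose e := z^-1 *: w.
have e1 : det3 u v e = 1.
  by rewrite /e -[_ *: _]addr0 -(scale0r 0) det3_lin3 mul0r addr0 mulVf.
have := cramer (seg_point w w' t) e1; rewrite zt scale0r addr0.
set x := det3 _ v e; set y := det3 u _ e => dec.
exists t, x, y; split=> //; first exact: itv01.
move=> t' x' y' dec'.
have : lin z z' t' = 0.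
  rewrite /z /z' -det3_seg dec' det3_lin3.
  by rewrite !det3E; ring.
rewrite /lin => zt'.
have tt : t' = t by rewrite /t; apply: (mulIf d0); rewrite divfK //; lra.
rewrite tt in dec'.
split.
  by rewrite /x dec' det3_lin1 e1 (_ : det3 v v e = 0) ?mulr0 ?mulr1 ?addr0 // det3E; ring.
by rewrite /y dec' det3_lin2 e1 (_ : det3 u u e = 0) ?mulr0 ?mulr1 ?add0r // det3E; ring.
Qed.

(** Negating the segment exchanges the upper and the lower half-plane.  A
    segment crosses their union, the plane spanned by [u] and [v], exactly when
    its end points lie on different sides. *)
Lemma half_parity u v w w' : det3 u v w != 0 -> det3 u v w' != 0 ->
  (forall t r : R, 0 <= t <= 1 -> seg_point w w' t <> r *: u /\ seg_point w w' t <> r *: v) ->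
  parity (half_term u v w w') (+) parity (half_term u v (- w) (- w')) =
  (0 < det3 u v w) (+) (0 < det3 u v w').
Proof.
move=> z0 z1 off; rewrite /half_term !parityD !parity_cone !det3_quarter !det3N !oppr_gt0.
have neg (x : R) : x != 0 -> (x < 0) = ~~ (0 < x).
  by move=> x0; rewrite -leNgt le_eqVlt (negbTE x0).
rewrite !neg // addNb addbN negbK [RHS]addbC.
set J := (0 < det3 u v w') (+) (0 < det3 u v w).
case ne : J => //=; rewrite /J in ne.
have [t [x [y [ht dec un]]]] := plane_crossing z0 z1 (etrans (negb_eqb _ _) ne).
have x0 : x != 0.
  by apply/eqP => x0; case: (off t y ht) => _; apply; rewrite dec x0 scale0r add0r.
have y0 : y != 0.
  by apply/eqP => y0; case: (off t x ht) => + _; apply; rewrite dec y0 scale0r addr0.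
have -> : `[< meets_cone u v w w' >] = (0 < x) && (0 < y).
  apply/asboolP/andP => [[t' [x' [y' [_ ? ? /un[<- <-]]]]]|[? ?]] //.
  by exists t, x, y.
have -> : `[< meets_cone v (- u) w w' >] = (0 < y) && ~~ (0 < x).
  rewrite -neg //; apply/asboolP/andP => [[t' [x' [y' [_ hx hy h]]]]|[? ?]].
    have [<- <-] : - y' = x /\ x' = y by apply: (un t'); rewrite h scalerN scaleNr addrC.
    by rewrite oppr_lt0.
  by exists t, y, (- x); rewrite oppr_gt0 dec scaleNr scalerN opprK addrC.
have -> : `[< meets_cone u v (- w) (- w') >] = ~~ (0 < x) && ~~ (0 < y).
  rewrite -!neg //; apply/asboolP/andP => [[t' [x' [y' [_ hx hy h]]]]|[? ?]].
    have [<- <-] : - x' = x /\ - y' = y.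
      by apply: (un t'); apply: oppr_inj; rewrite -seg_pointN h !scaleNr -opprD opprK.
    by rewrite !oppr_lt0.
  by exists t, (- x), (- y); rewrite !oppr_gt0 seg_pointN dec !scaleNr -opprD.
have -> : `[< meets_cone v (- u) (- w) (- w') >] = ~~ (0 < y) && (0 < x).
  rewrite -neg //; apply/asboolP/andP => [[t' [x' [y' [_ hx hy h]]]]|[? ?]].
    have [<- <-] : y' = x /\ - x' = y.
      apply: (un t'); apply: oppr_inj; rewrite -seg_pointN h scalerN scaleNr opprD opprK.
      by rewrite addrC.
    by rewrite oppr_lt0.
  by exists t, (- y), x; rewrite oppr_gt0 seg_pointN dec scaleNr scalerN opprD addrC.
by case: (0 < x); case: (0 < y).
Qed.

Variables (V : finType) (e : rel V) (f : spatial_embedding R e).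
Hypothesis complete : forall x y, e x y = (x != y).
Variables (u v : point).
Hypotheses (gu : generic f u) (gv : generic f v).
Hypothesis uv_transverse : forall a b, a \in arc_points f -> b \in arc_points f ->
  a != b -> det3 u v (a - b) != 0.
Implicit Types x y z : V.

Lemma independent_opp d (ed ed' : point * point) :
  independent_edges d ed ed' -> independent_edges (- d) ed ed'.
Proof.
move=> [h1 h2 h3]; split=> // r t ht; rewrite scalerN -scaleNr.
  exact: h2.
exact: h3.
Qed.

Lemma arc_transverse x y z (w : V) ed ed' : uniq [:: x; y; z; w] ->
  ed \in arc_edges f x y -> ed' \in arc_edges f z w -> transverse u v ed ed'.
Proof.
move=> un hed hed'.
have [m1 m2] := arc_points_edge hed; have [m1' m2'] := arc_points_edge hed'.
have [dis _ _] := generic_independent complete gu un hed hed'.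
have j0 : 0 <= (0 : R) <= 1 by rewrite lexx ler01.
have j1 : 0 <= (1 : R) <= 1 by rewrite lexx ler01.
move: (dis _ _ j0 j0) (dis _ _ j0 j1) (dis _ _ j1 j0) (dis _ _ j1 j1).
rewrite !seg_point0 !seg_point1 => /eqP d1 /eqP d2 /eqP d3 /eqP d4.
by rewrite /transverse !uv_transverse.
Qed.

Lemma arc_first x y : exists2 ed, ed \in arc_edges f x y & ed.1 = pos f x.
Proof.
rewrite /arc_edges /edge_arc /arc_path /path_edges /=; case: (bends f x y) => [|a s] /=.
  by exists (pos f x, pos f y); rewrite ?mem_head.
by exists (pos f x, a); rewrite ?mem_head.
Qed.

Lemma arc_last x y : exists2 ed, ed \in arc_edges f x y & ed.2 = pos f y.
Proof.
rewrite /arc_edges /edge_arc /arc_path.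
case/lastP: (bends f x y) => [|s a]; first by
  exists (pos f x, pos f y); rewrite ?mem_head.
by exists (a, pos f y) => //; rewrite path_edges_rcons mem_rcons inE eqxx.
Qed.

(** The parity of the number of points of the arc [yz] vertically below the
    vertex [x], in the picture seen along [u] with [v] pointing upwards. *)
Definition above x y z : bool :=
  parity (\sum_(ed <- arc_edges f y z) half_term u v (pos f x - ed.1) (pos f x - ed.2)).

Definition side x y : bool := 0 < det3 u v (pos f x - pos f y).

(** The vertical line through [q] meets the arc an odd number of times exactly
    when it separates the ends of the arc, which is what [side] records. *)
Lemma below_above x y q z : uniq [:: x; y; q; z] ->
  parity (\sum_(ed <- arc_edges f x y) half_term u v (ed.1 - pos f q) (ed.2 - pos f q)) =
  above q x y (+) (side q x (+) side q y).
Proof.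
move=> un; have [ed' hed' e1'] := arc_first q z.
rewrite /above !parity_sum.
have -> : side q x (+) side q y = \big[addb/false]_(ed <- arc_edges f x y)
    ((0 < det3 u v (pos f q - ed.1)) (+) (0 < det3 u v (pos f q - ed.2))).
  exact/esym/(path_telescope_xor (bends f x y) _ _ (fun a => 0 < det3 u v (pos f q - a))).
rewrite -big_split /=; apply: eq_big_seq => ed hed.
have [_ off _] := generic_independent complete gu un hed hed'.
have [_ offu _] := independent_edgesC (generic_independent complete gu un hed hed').
have [_ offv _] := independent_edgesC (generic_independent complete gv un hed hed').
have /and4P[] := arc_transverse un hed hed'; rewrite e1' => z1 z2 _ _.
have zN (a : point) : det3 u v (a - pos f q) != 0 -> det3 u v (pos f q - a) != 0.
  by rewrite -opprB det3N oppr_eq0.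
have := @half_parity u v (pos f q - ed.1) (pos f q - ed.2) (zN _ z1) (zN _ z2).
rewrite !opprB => <-; first by rewrite addKb.
move=> t r ht.
have sE : seg_point (pos f q - ed.1) (pos f q - ed.2) t = pos f q - seg_point ed.1 ed.2 t.
  rewrite /seg_point !scalerBr addrACA -scalerDl subrK scale1r; congr (_ + _).
  by rewrite opprD.
have bad d : ends_off_line d ed' ed -> pos f q - seg_point ed.1 ed.2 t <> r *: d.
  move=> off1 h; have [+ _] := off1 (- r) t ht; apply.
  by rewrite e1' scaleNr -h opprB addrC subrK.
by rewrite sE; split; apply: bad.
Qed.

Definition arc_cross x y z (w : V) : int := over_sum u (arc_edges f x y) (arc_edges f z w).

(** The left side counts all crossings of the two arcs, that is, over-crossings
    along [u] and along [- u].  Modulo 2 it is the change of the count when [u]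
    is turned through [v] to [- u], and that is a sum over the end points. *)
Lemma crossing_parity x y z (w : V) : uniq [:: x; y; z; w] ->
  parity (arc_cross x y z w) (+) parity (arc_cross z w x y) =
  above x z w (+) above y z w (+) above z x y (+) above w x y (+)
  (side z x (+) side z y (+) side w x (+) side w y).
Proof.
move=> un; rewrite /arc_cross -[X in _ (+) parity X]over_sum_opp.
rewrite -parityN -parityD addrC.
have -> : over_sum (- u) (arc_edges f x y) (arc_edges f z w)
   - over_sum u (arc_edges f x y) (arc_edges f z w) =
   (over_sum (- u) (arc_edges f x y) (arc_edges f z w) -
    over_sum v (arc_edges f x y) (arc_edges f z w)) +
   (over_sum v (arc_edges f x y) (arc_edges f z w) -
   over_sum u (arc_edges f x y) (arc_edges f z w)) by rewrite subrKA.
rewrite over_sum_change; last first.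
  move=> ed ed' hed hed'; split.
  - exact: generic_independent hed hed'.
  - by apply: independent_opp; apply: generic_independent hed hed'.
  - by have := arc_transverse un hed hed'; rewrite /transverse !det3_quarter.
rewrite over_sum_change; last first.
  move=> ed ed' hed hed'; split.
  - exact: generic_independent hed hed'.
  - exact: generic_independent hed hed'.
  - exact: arc_transverse hed hed'.
rewrite addrACA -!big_split /= parityD.
have un' : uniq [:: x; y; w; z].
  move: un; rewrite /= !inE !negb_or !andbT (eq_sym w z) -!andbA.
  by case/and5P=> -> -> -> -> /andP[-> ->].
pose F (ed : point * point) c := half_term u v (ed.1 - c) (ed.2 - c).
pose G (a : point) (ed' : point * point) := half_term u v (a - ed'.1) (a - ed'.2).
have eF : \sum_(ed <- arc_edges f x y)
   (\sum_(ed' <- arc_edges f z w)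
      (cone_term v (- u) (ed.1 - ed'.1) (ed.2 - ed'.1)
       - cone_term v (- u) (ed.1 - ed'.2) (ed.2 - ed'.2)) +
    \sum_(ed' <- arc_edges f z w)
      (cone_term u v (ed.1 - ed'.1) (ed.2 - ed'.1)
       - cone_term u v (ed.1 - ed'.2) (ed.2 - ed'.2)))
  = \sum_(ed <- arc_edges f x y) F ed (pos f z) - \sum_(ed <- arc_edges f x y) F ed (pos f w).
  rewrite -sumrB; apply: eq_bigr => ed _.
  rewrite -[RHS]opprB -(path_telescope (bends f z w)) -big_split -sumrN /=.
  by apply: eq_bigr => ed' _; rewrite /F /half_term; ring.
have eG : \sum_(ed' <- arc_edges f z w)
   (\sum_(ed <- arc_edges f x y)
      (cone_term v (- u) (ed.2 - ed'.1) (ed.2 - ed'.2)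
       - cone_term v (- u) (ed.1 - ed'.1) (ed.1 - ed'.2)) +
    \sum_(ed <- arc_edges f x y)
      (cone_term u v (ed.2 - ed'.1) (ed.2 - ed'.2)
       - cone_term u v (ed.1 - ed'.1) (ed.1 - ed'.2)))
  = \sum_(ed' <- arc_edges f z w) G (pos f y) ed'
    - \sum_(ed' <- arc_edges f z w) G (pos f x) ed'.
  rewrite -sumrB; apply: eq_bigr => ed' _.
  rewrite -(path_telescope (bends f x y) _ _ (fun a => G a ed')) -big_split /=.
  by apply: eq_bigr => ed _; rewrite /G /half_term; ring.
rewrite eF eG !parityD !parityN (below_above un) (below_above un').
rewrite -/(above y z w) -/(above x z w).
move: (above _ _ _) (above _ _ _) (above _ _ _) (above _ _ _)
  (side _ _) (side _ _) (side _ _) (side _ _).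
by do 8!case.
Qed.

Lemma side_anti x y : x != y -> side y x = ~~ side x y.
Proof.
move=> xy; rewrite /side -opprB det3N oppr_gt0.
have : det3 u v (pos f x - pos f y) != 0.
  have [ed hed e1] := arc_first x y; have [ed' hed' e2] := arc_last x y.
  rewrite -e1 -e2 uv_transverse ?(arc_points_edge hed).1 ?(arc_points_edge hed').2 //.
  by rewrite e1 e2; apply: contraNneq xy => /(@pos_inj _ _ _ f) ->.
by rewrite -leNgt => n0; rewrite le_eqVlt (negbTE n0).
Qed.

(** [arc_cross] extended by zero to degenerate pairs, which makes it
    antisymmetric without side conditions. *)
Definition pair_cross x y z (w : V) : int :=
  if (x == y) || (z == w) then 0 else arc_cross x y z w.

Lemma pair_cross_antil x y z (w : V) : pair_cross y x z w = - pair_cross x y z w.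
Proof.
rewrite /pair_cross (eq_sym y); have [xy|xy] := eqVneq x y; first by rewrite oppr0.
by case: eqP => //= _; rewrite ?oppr0 // /arc_cross over_sum_arcNl // complete.
Qed.

Lemma pair_cross_antir x y z (w : V) : pair_cross x y w z = - pair_cross x y z w.
Proof.
rewrite /pair_cross (eq_sym w); have [zw|zw] := eqVneq z w; first by rewrite orbT oppr0.
by case: eqP => //= _; rewrite ?oppr0 // /arc_cross over_sum_arcNr // complete.
Qed.

End Parity.

(** * Linked triangles among six vertices *)

Section CG.

Definition triangle_xor (T : Type) (o : T -> T -> T -> T -> bool)
    (t t' : T * T * T) :=
  let: (a, b, c) := t in let: (d, e, g) := t' in
  \big[addb/false]_(x <- [:: (a, b); (b, c); (a, c)])
  \big[addb/false]_(y <- [:: (d, e); (e, g); (d, g)]) o x.1 x.2 y.1 y.2.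

(** The splittings of six vertices into two triangles, listed so that the last
    vertex is always in the second one. *)
Definition triangle_splits : seq ((nat * nat * nat) * (nat * nat * nat)) :=
  [:: ((0, 1, 2), (3, 4, 5)); ((0, 1, 3), (2, 4, 5)); ((0, 1, 4), (2, 3, 5));
      ((0, 2, 3), (1, 4, 5)); ((0, 2, 4), (1, 3, 5)); ((0, 3, 4), (1, 2, 5));
      ((1, 2, 3), (0, 4, 5)); ((1, 2, 4), (0, 3, 5)); ((1, 3, 4), (0, 2, 5));
      ((2, 3, 4), (0, 1, 5))]%N.

(** An edge at vertex 5 occurs with every edge disjoint from it in two
    splittings and cancels.  What remains is each ordered pair of disjoint edges
    of the first five vertices once, hence by the relation between [o], [h] and
    [s] a sum where every [h] occurs twice; the bits [s] add up to 1. *)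
Lemma triangle_splits_xor (o : nat -> nat -> nat -> nat -> bool)
    (h : nat -> nat -> nat -> bool) (s : nat -> nat -> bool) :
  (forall a b, all (gtn 6) [:: a; b] -> a != b -> s b a = ~~ s a b) ->
  (forall a b c d, all (gtn 6) [:: a; b; c; d] -> uniq [:: a; b; c; d] ->
     o a b c d (+) o c d a b =
     h a c d (+) h b c d (+) h c a b (+) h d a b (+)
     (s c a (+) s c b (+) s d a (+) s d b)) ->
  \big[addb/false]_(t <- triangle_splits) triangle_xor o t.1 t.2 = true.
Proof.
move=> s_anti rel0.
have rel a b c d : all (gtn 6) [:: a; b; c; d] -> uniq [:: a; b; c; d] ->
    o c d a b = o a b c d (+) (h a c d (+) h b c d (+) h c a b (+) h d a b (+)
     (s c a (+) s c b (+) s d a (+) s d b)).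
  by move=> lt6 u; rewrite -rel0 // addKb.
rewrite /triangle_splits !big_cons big_nil /= /triangle_xor !big_cons !big_nil /= !addbF.
rewrite (rel 0 1 2 3)%N // (rel 0 1 2 4)%N // (rel 0 1 3 4)%N // (rel 0 2 1 3)%N //.
rewrite (rel 0 2 1 4)%N // (rel 0 2 3 4)%N // (rel 0 3 1 2)%N // (rel 0 3 1 4)%N //.
rewrite (rel 0 3 2 4)%N // (rel 0 4 1 2)%N // (rel 0 4 1 3)%N // (rel 0 4 2 3)%N //.
rewrite (rel 1 2 3 4)%N // (rel 1 3 2 4)%N // (rel 1 4 2 3)%N //.
rewrite (s_anti 0 1)%N // (s_anti 0 2)%N // (s_anti 0 3)%N // (s_anti 0 4)%N //.
rewrite (s_anti 1 2)%N // (s_anti 1 3)%N // (s_anti 1 4)%N //.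
rewrite (s_anti 2 3)%N // (s_anti 2 4)%N // (s_anti 3 4)%N //.
have addE (a b : bool) : a (+) b = xorb a b by case: a b => [] [].
by rewrite !addE; btauto.
Qed.
End CG.

Section Triangles.

Definition triangle_sum (T : Type) (A : zmodType) (g : T -> T -> T -> T -> A)
    (t t' : T * T * T) : A :=
  let: (a, b, c) := t in let: (d, e, k) := t' in
  \sum_(x <- [:: (a, b); (b, c); (c, a)])
  \sum_(y <- [:: (d, e); (e, k); (k, d)]) g x.1 x.2 y.1 y.2.

Lemma triangle_sum_parity (T : Type) (g : T -> T -> T -> T -> int) t t' :
  (forall x y z w, g y x z w = - g x y z w) ->
  (forall x y z w, g x y w z = - g x y z w) ->
  parity (triangle_sum g t t') = triangle_xor (fun x y z w => parity (g x y z w)) t t'.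
Proof.
move=> gl gr; case: t t' => [[a b] c] [[d e] k]; rewrite /triangle_sum /triangle_xor.
rewrite !big_cons !big_nil /= !(gl a c) !(gr _ _ d k) !addr0 !addbF.
by rewrite !parityD !parityN.
Qed.

Definition triangle_map (T T' : Type) (h : T -> T') (t : T * T * T) :=
  (h t.1.1, h t.1.2, h t.2).

Lemma triangle_sum_map (T T' : Type) (A : zmodType) (g : T' -> T' -> T' -> T' -> A)
    (h : T -> T') t t' :
  triangle_sum g (triangle_map h t) (triangle_map h t') =
  triangle_sum (fun x y z w => g (h x) (h y) (h z) (h w)) t t'.
Proof.
by case: t t' => [[a b] c] [[a' b'] c'];
  rewrite /triangle_sum /triangle_map /= !big_cons !big_nil.
Qed.

(** The ten sums add up to an odd number by [crossing_parity] and
    [triangle_splits_xor], so they are not all zero. *)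
Lemma linked_triangles (R : realType) (V : finType) (e : rel V)
    (f : spatial_embedding R e) (u v : 'rV[R]_3) (h : nat -> V) :
  (forall x y, e x y = (x != y)) -> generic f u -> generic f v ->
  (forall a b, a \in arc_points f -> b \in arc_points f -> a != b ->
     det3 u v (a - b) != 0) ->
  uniq [seq h n | n <- iota 0 6] ->
  exists2 t, t \in triangle_splits &
    triangle_sum (pair_cross f u) (triangle_map h t.1) (triangle_map h t.2) != 0.
Proof.
move=> ce gu gv tr un.
have hI : {in iota 0 6 &, injective h}.
  move=> x y; rewrite !mem_iota !add0n => /andP[_ x6] /andP[_ y6] hxy.
  have nthE n : (n < 6)%N -> nth (h 0%N) [seq h n | n <- iota 0 6] n = h n.
    by move=> n6; rewrite (nth_map 0%N) ?size_iota // nth_iota.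
  apply/eqP; rewrite -(nth_uniq (h 0%N) _ _ un) ?size_map ?size_iota //.
  by rewrite !nthE // hxy.
have hU s : all (gtn 6) s -> uniq (map h s) = uniq s.
  move=> /allP s6; apply: map_inj_in_uniq => x y /s6 x6 /s6 y6.
  by apply: hI; rewrite mem_iota.
apply: contrapT => nolink.
have par0 t : t \in triangle_splits ->
    parity (triangle_sum (pair_cross f u) (triangle_map h t.1) (triangle_map h t.2)) = false.
  move=> ht.
  suff -> : triangle_sum (pair_cross f u) (triangle_map h t.1) (triangle_map h t.2) = 0
    by [].
  by apply: contrapT => /eqP k; apply: nolink; exists t.
have := @triangle_splits_xor
  (fun x y z w => parity (pair_cross f u (h x) (h y) (h z) (h w)))
  (fun x y z => above f u v (h x) (h y) (h z)) (fun x y => side f u v (h x) (h y)).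
rewrite big1_seq => [H|t /andP[_ ht]]; last first.
  rewrite -triangle_sum_parity => [|x y z w|x y z w].
  - by rewrite -(triangle_sum_map (pair_cross f u)) par0.
  - exact: pair_cross_antil.
  - exact: pair_cross_antir.
suff : false = true by [].
apply: H => [a b ab6 ab|a b c d lt6 abcd].
  by apply: (side_anti tr); have := hU _ ab6; rewrite /= !inE !andbT ab => ->.
have abcd' : uniq [:: h a; h b; h c; h d] by have := hU _ lt6; rewrite abcd => ->.
rewrite -(crossing_parity ce gu gv tr abcd') /pair_cross.
by move: abcd'; rewrite /= !inE !negb_or => /and4P[/and3P[/negbTE -> _ _] _ /negbTE -> _].
Qed.
End Triangles.
Arguments triangle_sum : simpl never.

(** * Second moments over all relabellings *)

Section Averaging.
Variable F : numFieldType.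

Lemma perm_of_uniq (I : finType) (s t : seq I) : uniq s -> uniq t -> size s = size t ->
  exists tau : {perm I}, map tau s = t.
Proof.
elim: s t => [|x s IH] [|y t] //= ; first by exists 1%g.
move=> /andP[xs us] /andP[yt ut] [st]; have [tau ht] := IH _ us ut st.
exists (tau * tperm (tau x) y)%g; rewrite permM tpermL; congr (_ :: _).
rewrite -[RHS]ht; apply/eq_in_map => z zs; rewrite permM tpermD //.
  by rewrite (inj_eq perm_inj); apply: contraNneq xs => ->.
by apply: contraNneq yt => ->; rewrite -ht map_f.
Qed.

Section Moments.
Variables (I : finType) (psi : I -> I -> F).
Hypothesis anti : forall i j, psi j i = - psi i j.

(** The correlation, up to a factor, of the values of [psi] on two randomly
    relabelled edges. *)
Definition moment2 a b c d : F := \sum_(s : {perm I}) psi (s a) (s b) * psi (s c) (s d).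

Lemma moment2_perm (tau : {perm I}) a b c d :
  moment2 (tau a) (tau b) (tau c) (tau d) = moment2 a b c d.
Proof.
rewrite /moment2 [RHS](reindex_inj (mulgI tau)) /=.
by apply: eq_bigr => s _; rewrite !permM.
Qed.

Lemma psi_diag i : psi i i = 0.
Proof.
have /eqP := anti i i; rewrite -addr_eq0 -mulr2n mulrn_eq0 /= => /eqP //.
Qed.

Lemma moment2C a b c d : moment2 a b c d = moment2 c d a b.
Proof. by apply: eq_bigr => s _; rewrite mulrC. Qed.

Lemma moment2Nl a b c d : moment2 b a c d = - moment2 a b c d.
Proof. by rewrite /moment2 -sumrN; apply: eq_bigr => s _; rewrite anti mulNr. Qed.

Hypothesis balanced : forall i, \sum_j psi i j = 0.

Lemma moment2_balanced a b c : \sum_d moment2 a b c d = 0.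
Proof.
rewrite /moment2 exchange_big big1 // => s _ /=; rewrite -mulr_sumr.
suff -> : \sum_d psi (s c) (s d) = 0 by rewrite mulr0.
by rewrite -[RHS](balanced (s c)) [RHS](reindex_inj (@perm_inj _ s)).
Qed.

(** Summed over all [d], the correlation vanishes because rows of [psi] sum to
    zero.  The term [d = c] is zero, the terms [d = a] and [d = b] cancel by
    exchanging [a] and [b], and the other terms are equal by symmetry. *)
Lemma moment2_disjoint a b c d : uniq [:: a; b; c; d] -> moment2 a b c d = 0.
Proof.
rewrite /= !inE !negb_or !andbT -!andbA => /and5P[ab ac ad bc /andP[bd cd]].
have := moment2_balanced a b c.
rewrite (bigD1 a) //= (bigD1 b) 1?eq_sym //= (bigD1 c) /=; last by rewrite !(eq_sym c) ac bc.
have -> : moment2 a b c c = 0 by apply: big1 => s _; rewrite psi_diag mulr0.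
have -> : moment2 a b c a = - moment2 a b c b.
  by rewrite -(moment2_perm (tperm a b)) tpermL tpermR tpermD // moment2Nl.
rewrite add0r addKr.
rewrite (eq_bigr (fun=> moment2 a b c d)) => [|x /andP[/andP[xa xb] xc]].
  rewrite sumr_const => /eqP; rewrite mulrn_eq0 => /orP[/eqP/card0_eq/(_ d)|/eqP] //.
  by rewrite unfold_in /= !(eq_sym d) ad bd cd.
rewrite -(moment2_perm (tperm x d)) tpermL !tpermD // 1?eq_sym //.
Qed.

Definition cycle_sum k (c : 'I_k -> I) (s : {perm I}) : F :=
  \sum_(i < k) psi (s (c i)) (s (c (ordS i))).

Lemma moment2_path a b c a' b' c' : uniq [:: a; b; c] -> uniq [:: a'; b'; c'] ->
  moment2 a b a b = moment2 a' b' a' b' /\ moment2 a b b c = moment2 a' b' b' c'.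
Proof.
move=> u u'; have [tau [<- <- <-]] := perm_of_uniq u u' erefl.
by rewrite !moment2_perm.
Qed.

Lemma ordS3 k (i : 'I_k) : (3 <= k)%N ->
  [/\ ordS i != i, ord_pred i != i & ord_pred i != ordS i].
Proof.
case: k i => // k [i hi] k3.
have eS : (i.+1 %% k.+1 = if i == k then 0 else i.+1)%N.
  by case: eqP => [->|ne]; rewrite ?modnn // modn_small //; lia.
have eP : ((i + k.+1).-1 %% k.+1 = if i == 0 then k else i.-1)%N.
  case: i {eS} hi => [|i] hi; first by rewrite add0n /= modn_small.
  by rewrite addSn /= modnDr modn_small //; lia.
by split; rewrite -val_eqE /= ?eS ?eP; do ?[case: eqP]; lia.
Qed.

(** Each edge of the cycle contributes its variance and its correlation with
    its two neighbours; edges further away are uncorrelated. *)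
Lemma cycle_sum_square k (c : 'I_k -> I) a b d : (3 <= k)%N -> injective c ->
  uniq [:: a; b; d] ->
  \sum_s cycle_sum c s ^+ 2 = k%:R * (moment2 a b a b + moment2 a b b d *+ 2).
Proof.
move=> k3 ci un.
have -> : \sum_s cycle_sum c s ^+ 2 =
    \sum_(i < k) \sum_(j < k) moment2 (c i) (c (ordS i)) (c j) (c (ordS j)).
  under eq_bigr => s _ do rewrite expr2 /cycle_sum mulr_suml.
  rewrite exchange_big /=; apply: eq_bigr => i _.
  under eq_bigr => s _ do rewrite mulr_sumr.
  by rewrite exchange_big.
rewrite (eq_bigr (fun=> moment2 a b a b + moment2 a b b d *+ 2)); last first.
  move=> i _; have [n1 n2 n3] := ordS3 i k3.
  have [n1' n2' n3'] := ordS3 (ordS i) k3; have [m1 m2 m3] := ordS3 (ord_pred i) k3.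
  have ppS : ordS (ord_pred i) = i by rewrite ord_predK.
  have pSp : ord_pred (ordS i) = i by rewrite ordSK.
  rewrite pSp in n2' n3'; rewrite ppS in m1 m3.
  have u1 : uniq [:: c i; c (ordS i); c (ordS (ordS i))].
    rewrite -[X in uniq X]/(map c [:: i; ordS i; ordS (ordS i)]) map_inj_uniq //=.
    by rewrite !inE negb_or n2' n3' eq_sym n1'.
  have u2 : uniq [:: c (ord_pred i); c i; c (ordS i)].
    rewrite -[X in uniq X]/(map c [:: ord_pred i; i; ordS i]) map_inj_uniq //=.
    by rewrite !inE negb_or n2 n3 n2'.
  rewrite (bigD1 i) //= (bigD1 (ordS i)) //= (bigD1 (ord_pred i)) /=; last first.
    by rewrite n2 n3.
  rewrite ppS (moment2C (c i) (c (ordS i)) (c (ord_pred i)) (c i)).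
  have [-> ->] := moment2_path u1 un; have [_ ->] := moment2_path u2 un.
  rewrite big1 ?addr0 ?mulr2n // => j /andP[/andP[ji jS] jp].
  apply: moment2_disjoint.
  rewrite -[X in uniq X]/(map c [:: i; ordS i; j; ordS j]) map_inj_uniq //=.
  rewrite !inE !negb_or n2' (eq_sym i j) ji (eq_sym _ j) jS (inj_eq (can_inj (@ordSK _))).
  have [jS1 _ _] := ordS3 j k3.
  rewrite !(eq_sym _ (ordS j)) jS1 (eq_sym i j) ji !andbT /=.
  by apply: contraNneq jp => <-; rewrite ordSK.
by rewrite sumr_const card_ord mulr_natl.
Qed.

Lemma cycle_sum_ratio k l (c : 'I_k -> I) (d : 'I_l -> I) : (3 <= k)%N -> (3 <= l)%N ->
  injective c -> injective d ->
  l%:R * \sum_s cycle_sum c s ^+ 2 = k%:R * \sum_s cycle_sum d s ^+ 2.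
Proof.
move=> k3 l3 ci di.
pose i0 := Ordinal (leq_trans (isT : 0 < 3)%N k3).
pose i1 := Ordinal (leq_trans (isT : 1 < 3)%N k3).
pose i2 := Ordinal (leq_trans (isT : 2 < 3)%N k3).
have un : uniq [:: c i0; c i1; c i2] by rewrite /= !inE !(inj_eq ci).
by rewrite (cycle_sum_square k3 ci un) (cycle_sum_square l3 di un) mulrCA.
Qed.

End Moments.

(** [psi'] differs from [psi] by a coboundary, which is chosen to make the row
    sums zero and does not change sums over cycles. *)
Lemma cycle_sum_average (I : finType) (psi : I -> I -> F) k l (c : 'I_k -> I) (d : 'I_l -> I) :
  (forall i j, psi j i = - psi i j) -> (3 <= k)%N -> (3 <= l)%N ->
  injective c -> injective d ->
  l%:R * \sum_s cycle_sum psi c s ^+ 2 = k%:R * \sum_s cycle_sum psi d s ^+ 2.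
Proof.
move=> anti k3 l3 ci di.
have I0 : #|I|%:R != 0 :> F.
  rewrite pnatr_eq0 -lt0n; apply/card_gt0P.
  by exists (c (Ordinal (leq_trans (isT : 0 < 3)%N k3))).
pose phi i := (\sum_j psi i j) / #|I|%:R.
pose psi' i j := psi i j - phi i + phi j.
have anti' i j : psi' j i = - psi' i j by rewrite /psi' anti; ring.
have bal i : \sum_j psi' i j = 0.
  rewrite big_split sumrB /= sumr_const -[phi i *+ _]mulr_natr divfK //.
  rewrite -mulr_suml subrr add0r.
  have -> : \sum_i \sum_j psi i j = 0 :> F.
    set S := (X in X = _); have /eqP : S = - S.
      by rewrite {1}/S exchange_big -sumrN; apply: eq_bigr => a _;
        rewrite -sumrN; apply: eq_bigr.
    by rewrite -addr_eq0 -mulr2n mulrn_eq0 => /eqP.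
  by rewrite mul0r.
have same n (b : 'I_n -> I) s : cycle_sum psi b s = cycle_sum psi' b s.
  rewrite /cycle_sum /psi' big_split sumrB /= -[LHS]addr0 -addrA; congr (_ + _).
  rewrite [X in _ + X](_ : _ = \sum_(i < n) phi (s (b i))) ?addNr //.
  by rewrite [RHS](reindex_inj (can_inj (@ordSK n))).
under eq_bigr do rewrite same; under [in RHS]eq_bigr do rewrite same.
exact: cycle_sum_ratio.
Qed.

(** Averaging over a group may be done first over the translates by lifted
    permutations of [I]. *)
Lemma equivariant_average (I : finType) (gT : finGroupType) (lift : {perm I} -> gT)
    (Psi : gT -> I -> I -> F) k l (c : 'I_k -> I) (d : 'I_l -> I) :
  (forall g i j, Psi g j i = - Psi g i j) ->
  (forall s g i j, Psi (lift s * g)%g i j = Psi g (s i) (s j)) ->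
  (3 <= k)%N -> (3 <= l)%N -> injective c -> injective d ->
  l%:R * \sum_g (\sum_(i < k) Psi g (c i) (c (ordS i))) ^+ 2 =
  k%:R * \sum_g (\sum_(i < l) Psi g (d i) (d (ordS i))) ^+ 2.
Proof.
move=> anti equi k3 l3 ci di.
have avg n (b : 'I_n -> I) :
    #|{perm I}|%:R * \sum_g (\sum_(i < n) Psi g (b i) (b (ordS i))) ^+ 2 =
    \sum_g \sum_s cycle_sum (Psi g) b s ^+ 2.
  rewrite exchange_big mulr_natl -sumr_const; apply: eq_bigr => s _.
  rewrite (reindex_inj (mulgI (lift s))) /=; apply: eq_bigr => g _; congr (_ ^+ 2).
  by apply: eq_bigr => i _; rewrite equi.
have P0 : #|{perm I}|%:R != 0 :> F.
  by rewrite pnatr_eq0 -lt0n; apply/card_gt0P; exists 1%g.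
apply: (mulfI P0); rewrite !(mulrCA #|_|%:R) !avg !mulr_sumr.
by apply: eq_bigr => g _; apply: cycle_sum_average.
Qed.

Section Blocks.
Variables p q : nat.

Definition block_fun (s : {perm 'I_p}) (t : {perm 'I_q}) (x : 'I_(p + q)) : 'I_(p + q) :=
  match split x with inl i => lshift q (s i) | inr j => rshift p (t j) end.

Lemma block_fun_inj s t : injective (block_fun s t).
Proof.
apply: (can_inj (g := block_fun s^-1%g t^-1%g)) => x; rewrite /block_fun.
case: (splitP x) => i xi.
  rewrite (_ : lshift q (s i) = unsplit (inl (s i))) // unsplitK permK.
  exact: val_inj.
rewrite (_ : rshift p (t i) = unsplit (inr (t i))) // unsplitK permK.
exact: val_inj.
Qed.

Definition block_perm s t : {perm 'I_(p + q)} := perm (@block_fun_inj s t).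

Lemma block_perml s t i : block_perm s t (lshift q i) = lshift q (s i).
Proof. by rewrite permE /block_fun -[lshift q i]/(unsplit (inl i)) unsplitK. Qed.
Lemma block_permr s t j : block_perm s t (rshift p j) = rshift p (t j).
Proof. by rewrite permE /block_fun -[rshift p j]/(unsplit (inr j)) unsplitK. Qed.

Variable ell : 'I_(p + q) -> 'I_(p + q) -> 'I_(p + q) -> 'I_(p + q) -> F.
Hypothesis ell_antil : forall x y z w, ell y x z w = - ell x y z w.
Hypothesis ell_antir : forall x y z w, ell x y w z = - ell x y z w.

Definition link_sum k l (c : 'I_k -> 'I_p) (d : 'I_l -> 'I_q) (g : {perm 'I_(p + q)}) : F :=
  \sum_(i < k) \sum_(j < l) ell (g (lshift q (c i))) (g (lshift q (c (ordS i))))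
                             (g (rshift p (d j))) (g (rshift p (d (ordS j)))).

(** The two cycles are replaced one after the other, each time relabelling only
    the block of vertices on which that cycle lives. *)
Lemma link_sum_average k l k' l' (c : 'I_k -> 'I_p) (d : 'I_l -> 'I_q)
    (c' : 'I_k' -> 'I_p) (d' : 'I_l' -> 'I_q) :
  (3 <= k)%N -> (3 <= l)%N -> (3 <= k')%N -> (3 <= l')%N ->
  injective c -> injective d -> injective c' -> injective d' ->
  (k' * l')%:R * \sum_g link_sum c d g ^+ 2 = (k * l)%:R * \sum_g link_sum c' d' g ^+ 2.
Proof.
move=> k3 l3 k3' l3' ci di ci' di'.
have step1 : k'%:R * \sum_g link_sum c d g ^+ 2 = k%:R * \sum_g link_sum c' d g ^+ 2.
  apply: (equivariant_average (lift := fun s => block_perm s 1%g)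
    (Psi := fun g x y => \sum_(j < l) ell (g (lshift q x)) (g (lshift q y))
       (g (rshift p (d j))) (g (rshift p (d (ordS j)))))) => //.
    by move=> g i j; rewrite -sumrN; apply: eq_bigr => a _; rewrite ell_antil.
  move=> s g i j; apply: eq_bigr => a _.
  by rewrite !permM !block_perml !block_permr !perm1.
have step2 : l'%:R * \sum_g link_sum c' d g ^+ 2 = l%:R * \sum_g link_sum c' d' g ^+ 2.
  have ex n (b : 'I_n -> 'I_q) g : link_sum c' b g = \sum_(j < n) \sum_(i < k')
     ell (g (lshift q (c' i))) (g (lshift q (c' (ordS i))))
         (g (rshift p (b j))) (g (rshift p (b (ordS j)))).
    by rewrite /link_sum exchange_big.
  under eq_bigr do rewrite ex; under [in RHS]eq_bigr do rewrite ex.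
  apply: (equivariant_average (lift := fun s => block_perm 1%g s)
    (Psi := fun g x y => \sum_(i < k') ell (g (lshift q (c' i))) (g (lshift q (c' (ordS i))))
       (g (rshift p x)) (g (rshift p y)))) => //.
    by move=> g i j; rewrite -sumrN; apply: eq_bigr => a _; rewrite ell_antir.
  move=> s g i j; apply: eq_bigr => a _.
  by rewrite !permM !block_perml !block_permr !perm1.
by rewrite !natrM -!mulrA mulrCA step1 mulrCA step2.
Qed.

End Blocks.
End Averaging.

(** * The mean square of the linking number *)

Section Final.

Lemma next_enum n (i : 'I_n) : next (enum 'I_n) i = ordS i.
Proof.
have n0 : (0 < n)%N by apply: leq_ltn_trans (ltn_ord i).
have h := map_next (enum_uniq 'I_n).
have := congr1 (fun s => nth (ordS i) s i) h; rewrite /= (nth_map i) ?size_enum_ord //.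
rewrite nth_ord_enum => ->; apply: val_inj => /=.
rewrite -(nth_map _ 0%N) ?size_rot ?size_enum_ord // map_rot val_enum_ord.
case: n i n0 {h} => // n [i hi] _; rewrite rot1_cons nth_rcons size_iota /=.
move: hi; rewrite ltnS leq_eqVlt => /predU1P[->|hi]; first by rewrite ltnn eqxx modnn.
by rewrite hi nth_iota // modn_small // add1n ltnS.
Qed.

Lemma next_map_enum n (T : eqType) (h : 'I_n -> T) (i : 'I_n) : injective h ->
  next (map h (enum 'I_n)) (h i) = h (ordS i).
Proof. by move=> hi; rewrite next_map ?enum_uniq // next_enum. Qed.

Lemma enum_cycle n (V : finType) (e : rel V) (h : 'I_n -> V) : (3 <= n)%N -> injective h ->
  (forall x y, e x y = (x != y)) -> is_cycle e n (map h (enum 'I_n)).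
Proof.
move=> n3 hi ce; have uh : uniq (map h (enum 'I_n)) by rewrite map_inj_uniq ?enum_uniq.
split=> //; first by rewrite size_map size_enum_ord.
rewrite /ucycle uh andbT; apply: cycle_from_next => // x /mapP[i _ ->].
rewrite next_map_enum // ce (inj_eq hi) eq_sym.
by have [] := ordS3 i n3.
Qed.

Definition split_seq (T : Type) (t : (T * T * T) * (T * T * T)) :=
  [:: t.1.1.1; t.1.1.2; t.1.2; t.2.1.1; t.2.1.2; t.2.2].

Lemma triangle_sum_perm (F : numFieldType) (J : finType) (ell : J -> J -> J -> J -> F) t t' :
  uniq (split_seq t) -> uniq (split_seq t') ->
  \sum_(g : {perm J}) triangle_sum ell (triangle_map g t.1) (triangle_map g t.2) ^+ 2 =
  \sum_(g : {perm J}) triangle_sum ell (triangle_map g t'.1) (triangle_map g t'.2) ^+ 2.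
Proof.
move=> u u'; have [tau [e1 e2 e3 e4 e5 e6]] := perm_of_uniq u u' erefl.
rewrite [LHS](reindex_inj (mulgI tau)); apply: eq_bigr => g _.
have -> : triangle_map (tau * g)%g t.1 = triangle_map g t'.1
  by rewrite /triangle_map !permM e1 e2 e3.
by have -> : triangle_map (tau * g)%g t.2 = triangle_map g t'.2
  by rewrite /triangle_map !permM e4 e5 e6.
Qed.

Definition corners3 : 'I_3 * 'I_3 * 'I_3 := (inord 0, inord 1, inord 2).

Lemma sum_ordS3 (A : zmodType) (X : 'I_3 -> 'I_3 -> A) :
  \sum_(i < 3) X i (ordS i) =
  \sum_(x <- [:: (corners3.1.1, corners3.1.2); (corners3.1.2, corners3.2);
                (corners3.2, corners3.1.1)]) X x.1 x.2.
Proof.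
rewrite !big_ord_recl big_ord0 !big_cons big_nil.
by congr (X _ _ + (X _ _ + (X _ _ + _))); apply: val_inj; rewrite /= ?inordK.
Qed.

Lemma link_sum_triangle (F : numFieldType) p q (p3 : (3 <= p)%N) (q3 : (3 <= q)%N)
  (ell : 'I_(p + q) -> 'I_(p + q) -> 'I_(p + q) -> 'I_(p + q) -> F) (g : {perm 'I_(p + q)}) :
  link_sum ell (widen_ord p3) (widen_ord q3) g =
  triangle_sum ell (triangle_map (fun i : 'I_3 => g (lshift q (widen_ord p3 i))) corners3)
              (triangle_map (fun i : 'I_3 => g (rshift p (widen_ord q3 i))) corners3).
Proof.
rewrite /link_sum (sum_ordS3 (fun i i' => \sum_(j < 3) ell (g (lshift q (widen_ord p3 i)))
  (g (lshift q (widen_ord p3 i'))) (g (rshift p (widen_ord q3 j)))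
  (g (rshift p (widen_ord q3 (ordS j)))))).
rewrite /triangle_sum /triangle_map !big_cons !big_nil /=.
by rewrite !(sum_ordS3 (fun j j' => ell _ _ (g (rshift p (widen_ord q3 j)))
  (g (rshift p (widen_ord q3 j'))))) !big_cons !big_nil.
Qed.

(** For every relabelling, one of the ten splittings of the six chosen vertices
    contributes at least 1; all ten contribute the same after summing over the
    relabellings. *)
Lemma triangle_moment (R : realType) (J : finType) (e : rel J) (f : spatial_embedding R e)
    (u v : 'rV[R]_3) (t : (J * J * J) * (J * J * J)) :
  (forall x y, e x y = (x != y)) -> generic f u -> generic f v ->
  (forall a b, a \in arc_points f -> b \in arc_points f -> a != b -> det3 u v (a - b) != 0) ->
  uniq (split_seq t) ->
  #|{perm J}|%:R <= 10 * \sum_(g : {perm J})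
    triangle_sum (fun x y z w => (pair_cross f u x y z w)%:~R : rat)
      (triangle_map g t.1) (triangle_map g t.2) ^+ 2.
Proof.
move=> ce gu gv tr ut; set ell := fun x y z w : J => (pair_cross f u x y z w)%:~R : rat.
pose h n := nth t.1.1.1 (split_seq t) n.
have usplit t' : t' \in triangle_splits ->
    uniq (split_seq (triangle_map h t'.1, triangle_map h t'.2)).
  move=> ht; rewrite -[split_seq _]/(map h (split_seq t')).
  have /allP/(_ t' ht)/andP[ut' /allP lt] : all (fun t => uniq (split_seq t) &&
     all (fun n => n < 6)%N (split_seq t)) triangle_splits by [].
  rewrite map_inj_in_uniq // => x y /lt xt /lt yt /eqP.
  by rewrite nth_uniq // => /eqP.
have -> : 10 * (\sum_(g : {perm J})
      triangle_sum ell (triangle_map g t.1) (triangle_map g t.2) ^+ 2) =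
   \sum_(t' <- triangle_splits) \sum_(g : {perm J})
      triangle_sum ell (triangle_map g (triangle_map h t'.1))
        (triangle_map g (triangle_map h t'.2)) ^+ 2.
  rewrite [RHS](eq_big_seq (fun=> \sum_(g : {perm J})
      triangle_sum ell (triangle_map g t.1) (triangle_map g t.2) ^+ 2)).
    by move: (\sum_(g : {perm J}) _) => X; rewrite /triangle_splits !big_cons big_nil /=; ring.
  move=> t' /usplit ut'.
  by apply: (@triangle_sum_perm rat J ell (triangle_map h t'.1, triangle_map h t'.2) t).
rewrite exchange_big /= -[X in X <= _]sumr_const; apply: ler_sum => g _.
have un : uniq [seq g (h n) | n <- iota 0 6].
  by rewrite -[X in uniq X]/(map g (split_seq t)) map_inj_uniq //; exact: perm_inj.
have [t' ht' nz] := linked_triangles ce gu gv tr un.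
rewrite (big_rem t') //= -[1]addr0 lerD //; last by apply: sumr_ge0 => i _; rewrite sqr_ge0.
have -> : triangle_sum ell (triangle_map g (triangle_map h t'.1))
        (triangle_map g (triangle_map h t'.2)) =
    (triangle_sum (pair_cross f u) (triangle_map (g \o h) t'.1)
       (triangle_map (g \o h) t'.2))%:~R.
  by rewrite /triangle_sum /triangle_map /ell /= !big_cons !big_nil !rmorphD.
by rewrite -rmorphXn /= -[1]/(1%:~R) ler_int -gtz0_ge1 exprn_even_gt0.
Qed.
End Final.

Theorem corollary1p9 (R : realType) (p q : nat) (hp : (3 <= p)%N) (hq : (3 <= q)%N)
    (f : spatial_embedding R (complete_graph (p + q)))
    (m : nat) (hm : (0 < m)%N)
    (hpq : (90 * (m - 1) ^ 2 < p * q)%N) :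
  exists2 lambda : seq 'I_(p + q) * seq 'I_(p + q),
    Gamma (complete_graph (p + q)) p q lambda &
    m%:R <= `|linking_number (cycle_image f lambda.1) (cycle_image f lambda.2)|.
Proof.
have ce (x y : 'I_(p + q)) : complete_graph (p + q) x y = (x != y) by [].
have [u [v [gu gv tr]]] := generic_pair f.
pose ell x y z w : rat := (pair_cross f u x y z w)%:~R.
pose cl (g : {perm 'I_(p + q)}) (i : 'I_p) := g (lshift q i).
pose cr (g : {perm 'I_(p + q)}) (j : 'I_q) := g (rshift p j).
have cl_inj g : injective (cl g) by move=> i j /perm_inj/lshift_inj.
have cr_inj g : injective (cr g) by move=> i j /perm_inj/rshift_inj.
pose c1 g := map (cl g) (enum 'I_p); pose c2 g := map (cr g) (enum 'I_q).
have gam g : Gamma (complete_graph (p + q)) p q (c1 g, c2 g).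
  split; [exact: enum_cycle|exact: enum_cycle|].
  apply/hasPn => x /= /mapP[j _ ->]; apply/mapP => [[i _ /perm_inj/eqP]].
  by rewrite eq_rlshift.
pose z g : int := \sum_(i < p) \sum_(j < q)
  pair_cross f u (cl g i) (cl g (ordS i)) (cr g j) (cr g (ordS j)).
have lkE g : linking_number (cycle_image f (c1 g)) (cycle_image f (c2 g)) = (z g)%:~R.
  rewrite (linking_number_arcs ce gu (gam g)); congr (_%:~R).
  rewrite /c1 /c2 big_map big_enum /=; apply: eq_bigr => i _.
  rewrite big_map big_enum /=; apply: eq_bigr => j _.
  rewrite !next_map_enum // /pair_cross.
  have [ni _ _] := ordS3 i hp; have [nj _ _] := ordS3 j hq.
  by rewrite !(inj_eq (@cl_inj g)) !(inj_eq (@cr_inj g)) !(eq_sym _ (ordS _))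
    (negbTE ni) (negbTE nj).
have zE g : (z g)%:~R = link_sum ell id id g.
  rewrite /z /link_sum rmorph_sum /=; apply: eq_bigr => i _.
  by rewrite rmorph_sum.
apply: contrapT => none.
(* If all linking numbers were less than [m], so would be their root mean
   square over the relabellings. *)
have small g : (z g)%:~R ^+ 2 <= ((m - 1) ^ 2)%:R :> rat.
  have : ~ (m%:R <= `|(z g)%:~R : rat|).
    by move=> h; apply: none; exists (c1 g, c2 g) => //; rewrite lkE.
  move/negP; rewrite -ltNge -intr_norm -[m%:R]/(m%:Z%:~R) ltr_int => hz.
  rewrite -rmorphXn /= -[_%:R]/(((m - 1) ^ 2)%N%:Z%:~R) ler_int.
  have : (`|z g| <= (m - 1)%N%:Z)%R by lia.
  rewrite -[z g ^+ 2]real_normK ?num_real // => h.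
  have -> : Posz ((m - 1) ^ 2)%N = (Posz (m - 1)) ^+ 2.
    by rewrite -[((m - 1) ^ 2)%N]/((m - 1) * (m - 1))%N PoszM expr2.
  by rewrite lerXn2r // nnegrE; lia.
pose S := \sum_(g : {perm 'I_(p + q)}) link_sum ell id id g ^+ 2.
pose T := \sum_(g : {perm 'I_(p + q)}) link_sum ell (widen_ord hp) (widen_ord hq) g ^+ 2.
have ell1 x y w w' : ell y x w w' = - ell x y w w'.
  by rewrite /ell pair_cross_antil // rmorphN.
have ell2 x y w w' : ell x y w' w = - ell x y w w'.
  by rewrite /ell pair_cross_antir // rmorphN.
have wi n (n3 : (3 <= n)%N) : injective (widen_ord n3).
  by move=> i j /(congr1 val) /= ij; apply: val_inj.
have ST : 9 * S = (p * q)%:R * T.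
  exact: (@link_sum_average rat p q ell ell1 ell2 p q 3 3 id id (widen_ord hp) (widen_ord hq)).
pose N : rat := #|{perm 'I_(p + q)}|%:R.
have N0 : 0 < N by rewrite ltr0n; apply/card_gt0P; exists 1%g.
have SN : S <= N * ((m - 1) ^ 2)%:R.
  rewrite /N mulr_natl -sumr_const; apply: ler_sum => g _; rewrite -zE; exact: small.
have TN : N <= 10 * T.
  rewrite /T; under eq_bigr do rewrite link_sum_triangle.
  apply: (triangle_moment (t := (triangle_map (fun i => lshift q (widen_ord hp i)) corners3,
                    triangle_map (fun i => rshift p (widen_ord hq i)) corners3)) ce gu gv tr).
  set h1 := fun i : 'I_3 => _; set h2 := fun i : 'I_3 => _.
  rewrite -[split_seq _]/(map h1 [:: corners3.1.1; corners3.1.2; corners3.2] ++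
    map h2 [:: corners3.1.1; corners3.1.2; corners3.2]).
  have u3 : uniq [:: corners3.1.1; corners3.1.2; corners3.2]
    by rewrite /= !inE -!val_eqE /= !inordK.
  rewrite cat_uniq !map_inj_uniq // ?u3 /=.
  - by rewrite /h1 /h2 !inE !eq_rlshift.
  - by move=> i j /rshift_inj/(wi _ hq).
  - by move=> i j /lshift_inj/(wi _ hp).
have lt : 90 * ((m - 1) ^ 2)%:R < (p * q)%:R :> rat by rewrite -natrM ltr_nat.
have pqT : N * (p * q)%:R <= 10 * T * (p * q)%:R by rewrite ler_wpM2r ?ler0n.
have : 0 < N * ((p * q)%:R - 90 * ((m - 1) ^ 2)%:R) by rewrite mulr_gt0 ?subr_gt0.
by rewrite mulrBr; lra.
Qed.
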